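(* Let $G$ be a finite group, $\mathfrak{F}$ a solubly saturated formation containing the class $\mathfrak{U}$ of all finite supersolvable groups, and $E$ a normal subgroup of $G$ with $G/E\in\mathfrak{F}$. Let $X\unlhd G$ be such that $F^*(E)\leq X\leq E$. Suppose that for any non-cyclic Sylow subgroup $P$ of $X$, either every maximal subgroup of $P$ satisfies partial $\Pi$-property in $G$, or every cyclic subgroup of $P$ of prime order or of order $4$ (the latter only when $P$ is not quaternion-free) satisfies partial $\Pi$-property in $G$. Then $G\in\mathfrak{F}$.
   Context: All groups are finite. For a positive integer $n$ and a set of primes $\pi$, $n$ is a $\pi$-number if all its prime divisors lie in $\pi$ (so $1$ is a $\pi$-number for every $\pi$, including $\pi=\emptyset$); $\pi(H)$ is the set of prime divisors of $|H|$. Partial $\Pi$-property: a subgroup $H$ of $G$ satisfies partial $\Pi$-property in $G$ if there exists a chief series $1=G_0<G_1<\cdots<G_n=G$ of $G$ such that for every $1\leq i\leq n$, the index $|G/G_{i-1}:N_{G/G_{i-1}}(HG_{i-1}/G_{i-1}\cap G_i/G_{i-1})|$ is a $\pi(HG_{i-1}/G_{i-1}\cap G_i/G_{i-1})$-number. A group is quaternion-free if it has no section isomorphic to the quaternion group of order $8$; thus the condition on cyclic subgroups of order $4$ is imposed only when $P$ is a $2$-group that is not quaternion-free. A formation is a class of groups closed under homomorphic images and subdirect products. A formation $\mathfrak{F}$ is solubly saturated if $G\in\mathfrak{F}$ whenever $G/\Phi(N)\in\mathfrak{F}$ for some solvable normal subgroup $N$ of $G$. $F^*(E)$ is the generalized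 Fitting subgroup of $E$, i.e. its quasinilpotent radical (largest normal quasinilpotent subgroup). *)

(* Defs.v *)
From HB Require Import structures.
From mathcomp Require Import all_boot all_fingroup all_solvable.

Set Implicit Arguments.
Unset Strict Implicit.
Unset Printing Implicit Defensive.

Local Open Scope group_scope.

Definition group_class := forall gT : finGroupType, {group gT} -> Prop.

(* A homomorphic image may live in another ambient group, so closure under
   images includes closure under isomorphism. *)
Definition closed_homomorphic_image (F : group_class) : Prop :=
  forall (aT rT : finGroupType) (G : {group aT}) (f : {morphism G >-> rT}),
    F aT G -> F rT (f @* G)%G.

(* D is a subdirect product of G1 and G2; products of more factors are obtained
   by iteration. *)
Definition closed_subdirect (F : group_class) : Prop :=
  forall (gT1 gT2 : finGroupType) (G1 : {group gT1}) (G2 : {group gT2})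
         (D : {group gT1 * gT2}),
    [set x.1 | x in D] = G1 -> [set x.2 | x in D] = G2 ->
    F gT1 G1 -> F gT2 G2 -> F (gT1 * gT2)%type D.

Definition formation (F : group_class) : Prop :=
  closed_homomorphic_image F /\ closed_subdirect F.

Definition solubly_saturated (F : group_class) : Prop :=
  forall (gT : finGroupType) (G N : {group gT}),
    N <| G -> solvable N -> F _ (G / 'Phi(N))%G -> F _ G.

Definition supersolvable (gT : finGroupType) (G : {group gT}) : Prop :=
  exists2 s : seq {group gT},
    path [rel A B : {group gT} | [&& A \subset B, B <| G & cyclic (B / A)]]
         1%G s
    & last 1%G s = G.

Definition supersolvable_sub (F : group_class) : Prop :=
  forall (gT : finGroupType) (G : {group gT}), supersolvable G -> F gT G.

(* Every element of G induces an inner automorphism on every chief factor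
   K / L of G. *)
Definition quasinilpotent (gT : finGroupType) (G : {group gT}) : bool :=
  [forall L : {group gT}, forall K : {group gT},
    chief_factor G L K ==>
      [forall x in G / L, exists k in K / L, forall y in K / L,
         y ^ x == y ^ k]].

(* A product of normal quasinilpotent subgroups is quasinilpotent, so this join
   is the largest normal quasinilpotent subgroup F^*(G). *)
Definition generalized_Fitting (gT : finGroupType) (G : {group gT}) :
    {set gT} :=
  << \bigcup_(H : {group gT} | (H <| G) && quasinilpotent H) H >>.

Definition quaternion_free (gT : finGroupType) (G : {group gT}) : Prop :=
  forall H K : {group gT},
    H \subset G -> K <| H -> ~~ (H / K \isog 'Q_8).

(* A and B are the consecutive terms G_{i-1} and G_i of the chief series. *)
Definition Pi_index (gT : finGroupType) (G H A B : {group gT}) : bool :=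
  let S := (H * A) / A :&: B / A in
  \pi(S).-nat #|G / A : 'N_(G / A)(S)|.

Definition partial_Pi_property (gT : finGroupType) (H G : {group gT}) : Prop :=
  exists2 s : seq {group gT},
    path [rel A B : {group gT} | chief_factor G A B && Pi_index G H A B] 1%G s
    & last 1%G s = G.

Definition maximal_Pi (gT : finGroupType) (G P : {group gT}) : Prop :=
  forall M : {group gT}, maximal M P -> partial_Pi_property M G.

Definition cyclic_Pi (gT : finGroupType) (G P : {group gT}) : Prop :=
  forall C : {group gT}, C \subset P -> cyclic C ->
    prime #|C| \/ (#|C| = 4 /\ ~ quaternion_free P) ->
    partial_Pi_property C G.

(* Main.v *)
Require Import Defs.
From HB Require Import structures.
From mathcomp Require Import all_boot all_fingroup all_algebra all_solvable.
From mathcomp Require Import all_field all_character.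

(* If a p-subgroup H has the partial Pi-property, the sections it cuts out of a
   chief series are p-groups whose normaliser has p-power index; such a section
   is normal as soon as it is normalised by a Sylow p-subgroup of G, and it lies
   in O_p(G) in any case.  Playing this against a well chosen maximal or minimal
   subgroup of P gives two facts.
   - For the smallest prime p dividing |X|, X is p-nilpotent: a nonabelian
     G-chief factor, or an abelian one of rank greater than one, would contain
     such a section as a proper nontrivial part.  The case of minimal subgroups
     ends with Frobenius' fusion argument.
   - A normal p-subgroup with either property is hypercyclically embedded in G,
     that is, all G-chief factors below it have prime order.
   Hence, peeling off Sylow subgroups, X is hypercyclically embedded in G.  Then
   E :&: G^`(1) acts nilpotently on X; since 'C_E(F^*(E)) lies in F^*(E), it is
   nilpotent and so contained in F^*(E), and E is hypercyclically embedded too,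
   E / (E :&: G^`(1)) being central in G / (E :&: G^`(1)).  Finally a class F as in the statement
   is closed under extensions by normal subgroups of prime order: such an
   extension is a quotient of a fibre product with a subgroup of the holomorph
   of a cyclic group of order p^2, in which the prime order subgroup becomes a
   Frattini subgroup. *)

Set Implicit Arguments.
Unset Strict Implicit.
Unset Printing Implicit Defensive.

Local Open Scope group_scope.

(** The chief series in the partial Pi-property depends on the subgroup [H], so nothing is known
    about its terms. The arguments use a single step [A], [B] of it: the one where a given normal
    subgroup [X] is first met nontrivially, or first covered. In the first case [H :&: K] has a
    normaliser of [p]-power index for every normal [K] of [G] inside [X :&: B]; in the second
    [H <*> T] has one for every normal [T] between [X :&: A] and [X]. The two hypotheses call for
    opposite ends. The condition on maximal subgroups passes to quotients, so the induction divides
    by minimal normal subgroups and looks at the bottom; the condition on subgroups of order [p] or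
    4 passes to subgroups, so the induction descends to smaller normal subgroups and looks at the
    top. Prime order of a chief [p]-factor is detected by elements: it is enough that the
    [p']-elements of [residual p G] centralise the factor. This criterion fits coprime action, where
    triviality can be tested modulo a Frattini subgroup. *)

Inductive chain (T : Type) (r : T -> T -> Prop) (x : T) : T -> Prop :=
| chain0 : chain r x x
| chainS y z of chain r x y & r y z : chain r x z.

Lemma chain_trans T (r : T -> T -> Prop) x y z :
  chain r x y -> chain r y z -> chain r x z.
Proof. by move=> rxy; elim=> // t u _ rxt rtu; apply: chainS rtu. Qed.

Lemma chain1 T (r : T -> T -> Prop) x y : r x y -> chain r x y.
Proof. by move=> rxy; apply: chainS rxy; apply: chain0. Qed.

Lemma chain_jump T (r : T -> T -> Prop) (P : pred T) x y :
  chain r x y -> ~~ P x -> P y -> exists a b, [/\ r a b, ~~ P a & P b].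
Proof.
move=> rxy Px; elim: rxy => [Px'|a b _ IH rab Pb]; first by rewrite Px' in Px.
have [Pa|Pa] := boolP (P a); first exact: IH.
by exists a, b.
Qed.

Lemma chain_path T (r : rel T) x s : path r x s -> chain r x (last x s).
Proof.
elim/last_ind: s => [_|s y IHs]; first exact: chain0.
by rewrite rcons_path last_rcons => /andP[/IHs xs rsy]; apply: chainS rsy.
Qed.

(** * Hypercyclic embedding *)

(** Index 1 is allowed so that intersecting or joining a series with a normal subgroup gives such a
    series again, repeated terms included. *)
Definition prime_step (gT : finGroupType) (G A B : {group gT}) :=
  [/\ A <| G, B <| G, A \subset B & #|B : A| = 1%N \/ prime #|B : A|].

Definition hypercyclic (gT : finGroupType) (G : {group gT}) :=
  chain (prime_step G).

(* The smallest normal subgroup of G with abelian quotient of exponent dividing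
   p - 1; it acts trivially on every G-chief factor of order p. *)
Definition residual (gT : finGroupType) (p : nat) (G : {group gT}) :=
  <<G^`(1) :|: [set x ^+ p.-1 | x in G]>>.

Canonical residual_group gT p G := Eval hnf in [group of @residual gT p G].

Section Hypercyclic.

Variable gT : finGroupType.
Implicit Types (p : nat) (A B C D E G H K L M N P S T X Y : {group gT}).

Lemma dvdn_1_or_prime m n :
  m %| n -> n = 1%N \/ prime n -> m = 1%N \/ prime m.
Proof.
move=> dv [n1 | pn]; first by left; apply/eqP; rewrite -dvdn1 -n1.
by have /primeP[_ /(_ _ dv)/orP[/eqP|/eqP->]] := pn; [left | right].
Qed.

Lemma indexg_setI_dvd A B Y :
  A \subset B -> B \subset 'N(A) -> #|B :&: Y : A :&: Y| %| #|B : A|.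
Proof.
move=> sAB nAB.
have -> : #|B :&: Y : A :&: Y| = #|(B :&: Y) / A|.
  rewrite card_quotient ?(subset_trans (subsetIl _ _)) //.
  by rewrite -(indexgI _ A) setIAC (setIidPr sAB).
by rewrite -card_quotient // cardSg // quotientS ?subsetIl.
Qed.

Lemma indexg_joing_dvd A B Y :
  A \subset B -> B \subset 'N(Y) -> #|B <*> Y : A <*> Y| %| #|B : A|.
Proof.
move=> sAB nYB; have nYA := subset_trans sAB nYB.
have -> : #|B <*> Y : A <*> Y| = #|B : B :&: (A <*> Y)|.
  have -> : B <*> Y = (A <*> Y) * B.
    rewrite (norm_joinEl nYB) (norm_joinEl nYA) (normC nYB) (normC nYA) -mulgA (mulSGid sAB).
    reflexivity.
  by rewrite (indexMg (A <*> Y)%G) indexgI.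
have sABI : A \subset B :&: (A <*> Y) by rewrite subsetI sAB joing_subl.
by rewrite -(Lagrange_index (subsetIl B (A <*> Y)) sABI) dvdn_mulr.
Qed.

Lemma hypercyclicI G A B Y :
  Y <| G -> hypercyclic G A B -> hypercyclic G (A :&: Y)%G (B :&: Y)%G.
Proof.
move=> nsYG; elim=> [|C D _ IH [nsC nsD sCD prCD]]; first exact: chain0.
apply: chainS IH _; split; rewrite ?normalI ?setSI //.
apply: dvdn_1_or_prime prCD; apply: indexg_setI_dvd => //.
by rewrite (subset_trans (normal_sub nsD)) ?normal_norm.
Qed.

Lemma hypercyclicY G A B Y :
  Y <| G -> hypercyclic G A B -> hypercyclic G (A <*> Y)%G (B <*> Y)%G.
Proof.
move=> nsYG; elim=> [|C D _ IH [nsC nsD sCD prCD]]; first exact: chain0.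
apply: chainS IH _; split; rewrite ?normalY ?genS ?setSU //.
apply: dvdn_1_or_prime prCD; apply: indexg_joing_dvd => //.
by rewrite (subset_trans (normal_sub nsD)) ?normal_norm.
Qed.

Lemma hypercyclic_cosetpre G N (A B : {group coset_of N}) :
    N <| G -> hypercyclic (G / N) A B ->
  hypercyclic G (coset N @*^-1 A)%G (coset N @*^-1 B)%G.
Proof.
move=> nsNG; elim=> [|C D _ IH [nsC nsD sCD prCD]]; first exact: chain0.
have pre (E : {group coset_of N}) : E <| G / N -> coset N @*^-1 E <| G.
  by move=> nsE; rewrite -(quotientGK nsNG) cosetpre_normal.
apply: chainS IH _; split; rewrite ?pre ?morphpreS //.
by rewrite index_morphpre // im_coset subsetT.
Qed.

Lemma hypercyclic_quotient G N B :
  N <| G -> B <| G -> N \subset B -> hypercyclic (G / N) 1 (B / N) ->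
  hypercyclic G N B.
Proof.
move=> nsNG nsBG sNB; move/(hypercyclic_cosetpre nsNG).
have -> : (coset N @*^-1 (B / N))%G = B.
  by apply/val_inj/quotientGK/(normalS sNB (normal_sub nsBG)).
suff -> : (coset N @*^-1 1)%G = N by [].
by apply/val_inj; rewrite /= cosetpre1.
Qed.

Lemma hypercyclic_of_chief G A B :
    A <| G -> B <| G -> A \subset B ->
    (forall C D, chief_factor G C D -> A \subset C -> D \subset B ->
       prime #|D : C|) ->
  hypercyclic G A B.
Proof.
move=> nsA; have [n] := ubnP #|B|; elim: n B => // n IHn B ltBn nsB sAB chB.
have [eqAB | neAB] := eqVneq A B; first by rewrite eqAB; apply: chain0.
have prAB : A \proper B by rewrite properEneq neAB.
pose gP := [pred H : {group gT} | (H \proper B) && (G \subset 'N(H))].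
have [|C maxC sAC] := @maxgroup_exists _ gP A.
  by rewrite /= prAB normal_norm.
have /maxgroupP[/andP[prCB nCG] _] := maxC.
have nsC : C <| G by rewrite /normal nCG (subset_trans (proper_sub prCB)) ?normal_sub.
apply: (@chainS _ _ _ C).
  apply: IHn => // [|E D chE sAE sDC].
    by rewrite -ltnS (leq_trans _ ltBn) // ltnS proper_card.
  by apply: chB => //; rewrite (subset_trans sDC) ?proper_sub.
split; rewrite ?proper_sub //; right; apply: chB => //.
by rewrite /chief_factor /maxnormal maxC.
Qed.

Lemma minnormal_meet G K Y :
  minnormal K G -> Y <| G -> K :&: Y != 1 -> K \subset Y.
Proof.
case/mingroupP=> /andP[ntK nKG] minK nsY ntKY; apply/setIidPl.
by apply: minK; rewrite ?subsetIl // ntKY normsI // normal_norm.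
Qed.

(** At the step [C], [D] where [K] first meets the series nontrivially, [K :&: C = 1] and minimality
    gives [K \subset D], so [K] embeds in [D / C]. *)
Lemma hypercyclic_minnormal G A B K :
  hypercyclic G A B -> minnormal K G -> K \subset B -> K :&: A = 1 ->
  prime #|K|.
Proof.
move=> hAB minK sKB tiKA; have [/andP[ntK nKG] _] := mingroupP minK.
have [||C [D [[nsC nsD sCD prCD] tiKC ntKD]]] :=
  chain_jump (P := [pred Y : {group gT} | K :&: Y != 1]) hAB.
- by rewrite /= tiKA eqxx.
- by rewrite /= (setIidPl sKB).
move: tiKC; rewrite /= negbK => /eqP tiKC.
have sKD : K \subset D by apply: (minnormal_meet minK).
have dvK: #|K| %| #|D : C|.
  rewrite -(indexg1 K) -tiKC indexgI -indexMg.
  have nCK : K \subset 'N(C) by rewrite (subset_trans (subset_trans sKD (normal_sub nsD))) ?normal_norm.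
  by rewrite -norm_joinEr // indexSg ?joing_subl // join_subG sCD.
case: (dvdn_1_or_prime dvK prCD) => // K1.
by rewrite trivg_card1 K1 eqxx in ntK.
Qed.

Lemma residual_sub p G : residual p G \subset G.
Proof.
rewrite gen_subG subUset der_sub /=.
by apply/subsetP=> _ /imsetP[x Gx ->]; rewrite groupX.
Qed.

Lemma residual_der p G : G^`(1) \subset residual p G.
Proof. by rewrite sub_gen ?subsetUl. Qed.

Lemma residual_exp p G x : x \in G -> x ^+ p.-1 \in residual p G.
Proof. by move=> Gx; apply/mem_gen/setUP; right; apply: (imset_f (fun y => y ^+ p.-1)). Qed.

Lemma residual_normal p G : residual p G <| G.
Proof. by apply: sub_der1_normal; rewrite ?residual_der ?residual_sub. Qed.

(** The automorphism group of a group of order [p] is cyclic of order [p.-1], so commutators and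
    [p.-1]-th powers act trivially. *)
Lemma residual_cent_prime p G K :
  K <| G -> #|K| = p -> prime p -> residual p G \subset 'C(K).
Proof.
move=> nsKG oK prp; have cycA : cyclic (Aut K) by rewrite Aut_prime_cyclic ?oK.
have nKG := normal_norm nsKG; have nKx x : x \in G -> x \in 'N(K) := subsetP nKG x.
have cA x : x \in G -> conj_aut K x \in Aut K.
  move=> Gx; apply: (subsetP (Aut_conj_aut K G)).
  by rewrite mem_morphim ?nKx.
rewrite -ker_conj_aut gen_subG subUset; apply/andP; split.
  rewrite gen_subG; apply/subsetP=> _ /imset2P[x y Gx Gy ->].
  apply/kerP; first by rewrite groupR ?nKx.
  rewrite morphR ?nKx //; apply/eqP/commgP.
  by apply: (centsP (cyclic_abelian cycA)); apply: cA.
apply/subsetP=> _ /imsetP[x Gx ->]; apply/kerP; first by rewrite groupX ?nKx.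
rewrite morphX ?nKx // -(totient_prime prp) -oK -card_Aut_cyclic ?prime_cyclic ?oK //.
by rewrite expg_cardG ?cA.
Qed.

Lemma residual_quotient p G N : N <| G -> residual p G / N = residual p (G / N).
Proof.
move=> nsNG; have nNG := normal_norm nsNG.
rewrite /residual quotient_gen; last first.
  by rewrite (subset_trans _ nNG) // -gen_subG residual_sub.
rewrite quotientU quotient_der //; congr (generated (setU _ _)).
apply/setP=> xb; apply/idP/imsetP.
  case/morphimP=> _ _ /imsetP[x Gx ->] ->.
  by exists (coset N x); rewrite ?mem_quotient // morphX ?(subsetP nNG).
case=> _ /morphimP[x Nx Gx ->] ->; rewrite -morphX //.
by apply: mem_morphim; rewrite ?groupX //; apply: (imset_f (fun y => y ^+ p.-1)).
Qed.

End Hypercyclic.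

Section HypercyclicAction.

Variable gT : finGroupType.
Implicit Types (p : nat) (A B C D E G H K L M N P S T X Y : {group gT}).

Lemma prime_step_residual G A B p :
  A <| G -> B <| G -> A \subset B -> #|B : A| = p -> prime p ->
  [~: B, residual p G] \subset A.
Proof.
move=> nsA nsB sAB iBA prp.
have nAB : B \subset 'N(A) by rewrite (subset_trans (normal_sub nsB)) ?normal_norm.
have nAK : residual p G \subset 'N(A) by rewrite (subset_trans (residual_sub p G)) ?normal_norm.
rewrite -quotient_cents2 //.
rewrite centsC residual_quotient // residual_cent_prime ?quotient_normal //.
by rewrite card_quotient.
Qed.

Lemma prime_step_der G A B : prime_step G A B -> [~: B, G^`(1)] \subset A.
Proof.
case=> nsA nsB sAB [/eqP i1 | prBA]; last first.
  exact: subset_trans (commgS _ (residual_der _ _)) (prime_step_residual nsA nsB sAB _ prBA).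
rewrite indexg_eq1 in i1; rewrite (subset_trans (commSg _ i1)) //.
by rewrite commg_subl (subset_trans (der_sub 1 G)) ?normal_norm.
Qed.

(** In a coprime action centralisers map onto centralisers in quotients: [x] centralises [P / N], so
    ['C_P(<[x]>)] covers [P / N], and it contains [N]. *)
Lemma coprime_stab_cent P N x p :
    p.-group P -> N <| P -> x \in 'N(P) -> x \in 'N(N) -> p^'.-elt x ->
    x \in 'C(N) -> [~: P, <[x]>] \subset N -> x \in 'C(P).
Proof.
move=> pP nsN nPx nNx p'x cNx sRN.
have co : coprime #|P| #|<[x]>| by rewrite (pnat_coprime pP).
have := coprime_quotient_cent (normal_sub nsN) _ co (pgroup_sol pP).
rewrite cycle_subG => /(_ nNx) eqC.
have: 'C_(P / N)(<[x]> / N) = P / N.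
  apply/setIidPl; rewrite centsC quotient_cents2r //.
  by rewrite commGC.
rewrite -eqC => {}eqC.
have sNC : N \subset 'C_P(<[x]>).
  by rewrite subsetI (normal_sub nsN) centsC cycle_subG.
have nsNC : N <| 'C_P(<[x]>) := normalS sNC (subsetIl _ _) nsN.
have /setIidPl : 'C_P(<[x]>) = P by exact: quotient_inj nsNC nsN eqC.
by rewrite centsC cycle_subG.
Qed.

(** By the same covering property ['C_P(<[x]>)] supplements ['Phi(P)], whose elements are
    non-generators. *)
Lemma coprime_cent_quotPhi P x p :
    p.-group P -> x \in 'N(P) -> p^'.-elt x ->
    [~: P, <[x]>] \subset 'Phi(P) -> x \in 'C(P).
Proof.
move=> pP nPx p'x sRN.
have co : coprime #|P| #|<[x]>| by rewrite (pnat_coprime pP).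
have nPhx: <[x]> \subset 'N('Phi(P)).
  by rewrite (char_norm_trans (Phi_char P)) ?cycle_subG.
have := coprime_quotient_cent (Phi_sub P) nPhx co (pgroup_sol pP).
have -> : 'C_(P / 'Phi(P))(<[x]> / 'Phi(P)) = P / 'Phi(P).
  by apply/setIidPl; rewrite centsC quotient_cents2r // commGC.
move=> eqC; have nPhi := normal_norm (Phi_normal P).
have: 'Phi(P) <*> 'C_P(<[x]>) = P.
  rewrite norm_joinEr; last exact: subset_trans (subsetIl _ _) nPhi.
  by rewrite -quotientK ?eqC ?quotientGK ?Phi_normal // (subset_trans (subsetIl _ _) nPhi).
move/Phi_nongen; rewrite genGid => /setIidPl.
by rewrite centsC cycle_subG.
Qed.

Lemma hypercyclic_residual_cent G P x p :
    p.-group P -> hypercyclic G 1 P -> x \in residual p G -> p^'.-elt x ->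
  x \in 'C(P).
Proof.
move=> pP hP Kx p'x; have Gx := subsetP (residual_sub p G) x Kx.
elim: hP pP => [|A B _ IH [nsA nsB sAB prAB]] pB; first by rewrite cent1T inE.
have nx C : C <| G -> x \in 'N(C) by move/normal_norm/subsetP->.
apply: (@coprime_stab_cent B A _ p); rewrite ?nx ?IH ?(pgroupS sAB) //.
  exact: normalS sAB (normal_sub nsB) nsA.
case: prAB => [/eqP i1 | prAB].
  rewrite indexg_eq1 in i1; rewrite (subset_trans (commSg _ i1)) //.
  by rewrite commg_subl cycle_subG nx.
have iAB : #|B : A| = p.
  have : p.-nat #|B : A| by apply: pnat_dvd (dvdn_indexg B A) pB.
  by rewrite pnatE // => /eqP.
rewrite iAB in prAB; apply: subset_trans (prime_step_residual nsA nsB sAB iAB prAB).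
by rewrite commgS // cycle_subG.
Qed.

(** [x] and [x ^+ p.-1] generate the same cyclic group. Applied to elements of [X] when no prime
    below [p] divides [#|X|]. *)
Lemma coprime_pred_residual G p x : x \in G -> coprime #[x] p.-1 -> x \in residual p G.
Proof.
move=> Gx co; rewrite -cycle_subG.
have: generator <[x]> (x ^+ p.-1) by rewrite generator_coprime.
move/eqP->; rewrite cycle_subG; exact: residual_exp.
Qed.

End HypercyclicAction.

(** * Irreducible actions on elementary abelian groups *)

Section Irreducible.

Variable gT : finGroupType.
Implicit Types (p : nat) (A B C D E G H K L M N P S T X Y : {group gT}).

Lemma pquotient_of_elts p G C :
    G \subset 'N(C) -> (forall x, x \in G -> p^'.-elt x -> x \in C) ->
  p.-group (G / C).
Proof.
move=> nCG p'C; apply/pgroupP=> q prq dvq; apply/idPn=> neqp.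
have [xb Gxb oxb] := Cauchy prq dvq.
have /morphimP[x Nx Gx def_x] := Gxb.
have: p^'.-elt xb by rewrite /p_elt oxb pnatE.
move/constt_p_elt; rewrite def_x -morph_constt //= coset_id => [x1|]; last first.
  by apply: p'C; rewrite ?groupX ?p_elt_constt.
by move: prq; rewrite -oxb def_x /= -x1 order1.
Qed.

(* X ^ p - X splits over F_p, so an endomorphism killed by it has an eigenvalue. *)
Lemma abelem_eigenvector p L g :
    p.-abelem L -> L :!=: 1 -> g \in 'N(L) -> g ^+ p.-1 \in 'C(L) ->
  exists2 v, v \in L^# & v ^ g \in <[v]>.
Proof.
move=> abL ntL nLg cLg.
have nL : <[g]> \subset 'N(L) by rewrite cycle_subG.
pose rG := abelem_repr abL ntL nL; pose A := rG g.
have prp : prime p by have [] := pgroup_pdiv (abelem_pgroup abL) ntL.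
have Ap : (A ^+ p = A)%R.
  have gp1 : rG (g ^+ p.-1) = 1%:M%R.
    apply/row_matrixP=> i; rewrite rowE row1.
    apply: (@rVabelem_inj _ _ _ abL ntL); rewrite rVabelemJ ?mem_cycle //.
    by rewrite conjgE -(centP cLg) ?mem_rVabelem // mulKg.
  have [k ek] : exists k, p = k.+1 by exists p.-1; rewrite prednK ?prime_gt0.
  rewrite [X in (A ^+ X)%R]ek GRing.exprS.
  have {}ek : k = p.-1 by rewrite ek.
  have /= -> : (A ^+ k)%R = rG (g ^+ p.-1) by rewrite ek repr_mxX ?cycle_id.
  by rewrite gp1 -[RHS]mulmx1.
have [a singA] : exists a, ((A - a%:M)%R \notin unitmx).
  apply/existsP; apply: contraT; rewrite negb_exists => /forallP unitA.
  have : (\prod_a (A - a%:M) \is a GRing.unit)%R.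
    by apply: GRing.unitr_prod => a _; have := unitA a; rewrite negbK.
  have -> : (\prod_a (A - a%:M) = horner_mx A (\prod_a ('X - a%:P)))%R.
    rewrite GRing.rmorph_prod; apply: eq_bigr => a _.
    by rewrite GRing.rmorphB /= horner_mx_X horner_mx_C.
  rewrite -finField_genPoly GRing.rmorphB GRing.rmorphXn /= horner_mx_X card_Fp //.
  by rewrite Ap GRing.subrr GRing.unitr0.
have /eigenvalueP[v vA nzv] : eigenvalue A a.
  by rewrite /eigenvalue /eigenspace kermx_eq0 row_free_unit.
exists (rVabelem abL ntL v).
  rewrite !inE mem_rVabelem andbT; apply: contra nzv => /eqP v1.
  apply/eqP/(@rVabelem_inj _ _ _ abL ntL); rewrite v1.
  by rewrite rVabelem0.
by rewrite -(rVabelemJ abL ntL nL) ?cycle_id // vA rVabelemZ mem_cycle.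
Qed.

(** Since its [p']-elements act trivially, the residual [W] acts on [L] as its Sylow [p]-subgroup,
    which has nontrivial fixed points; minimality makes [W] centralise [L]. So [G] acts on [L] as an
    abelian group of exponent dividing [p.-1]. Each element has an eigenvector, and its eigenspace
    is invariant under [G], hence all of [L]. Thus [G] acts by scalars, and every cyclic subgroup of
    [L] is invariant. *)
Lemma minnormal_prime p G L :
    minnormal L G -> L \subset G -> p.-group L ->
    (forall x, x \in residual p G -> p^'.-elt x -> x \in 'C(L)) ->
  prime #|L|.
Proof.
move=> minL sLG pL p'L; have /mingroupP[/andP[ntL nLG] minL'] := minL.
have [_ _ /is_abelemP[q prq abL]] :=
  minnormal_solvable minL (subxx _) (pgroup_sol pL).
have {prq} eqp : q = p.
  have [_ _] := pgroup_pdiv (abelem_pgroup abL) ntL; case=> k oL.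
  by have := pL; rewrite /pgroup oL pnatX /= orbF pnatE // => /eqP.
rewrite {q}eqp in abL; pose W := residual_group p G.
have sWG : W \subset G := residual_sub p G.
have [S sylS] := Sylow_exists p W; have [sSW pS _] := and3P sylS.
have nCW : W \subset 'N('C_W(L)).
  by rewrite normsI ?normG // norms_cent // (subset_trans sWG).
have defW : S * 'C_W(L) = W.
  apply: coprime_index_mulG; rewrite ?subsetIl //.
  rewrite (@pnat_coprime p^') //; first by case/and3P: sylS.
  rewrite pnatNK -card_quotient //; apply: pquotient_of_elts => // x Wx p'x.
  by rewrite inE Wx p'L.
have nLS : S \subset 'N(L) by rewrite (subset_trans (subset_trans sSW sWG)).
have ntC : L :&: 'Z(S <*> L) != 1.
  apply: meet_center_nil => //; last by rewrite /normal joing_subr join_subG nLS normG.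
  by apply: (@pgroup_nil _ p); rewrite /= norm_joinEl // pgroupM pS.
have ntCW : 'C_L(W) != 1.
  apply: subG1_contra ntC; rewrite subsetI subsetIl /= -defW.
  rewrite centM subsetI; apply/andP; split.
    by rewrite subIset // orbC subIset // orbC centS ?joing_subl.
  by rewrite subIset // centsC subsetIr.
have cLW : W \subset 'C(L).
  rewrite centsC; apply/setIidPl/minL'; rewrite ?subsetIl // ntCW.
  by rewrite normsI // norms_cent // normal_norm // residual_normal.
have expL x v : x \in G -> v \in L -> exists k, v ^ x = v ^+ k.
  move=> Gx Lv; have [|w /setD1P[ntw Lw]] := abelem_eigenvector abL ntL (subsetP nLG x Gx).
    by apply: (subsetP cLW); apply: residual_exp.
  case/cycleP=> k wx; exists k.
  have cLL := abelem_abelian abL.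
  have gE : group_set [set u in L | u ^ x == u ^+ k].
    apply/group_setP; split=> [|u1 u2]; rewrite !inE ?conj1g ?expg1n ?group1 ?eqxx //.
    case/andP=> L1 /eqP u1x /andP[L2 /eqP u2x]; rewrite groupM //= conjMg u1x u2x.
    by rewrite expgMn //; apply: (centsP cLL).
  have eqE : Group gE = L :> {set gT}.
    apply: minL'; last by apply/subsetP=> u; rewrite inE; case/andP.
    apply/andP; split.
      by apply/trivgPn; exists w; rewrite // inE Lw wx /=.
    apply/subsetP=> y Gy; rewrite inE; apply/subsetP=> _ /imsetP[u /[!inE] /andP[Lu /eqP ux] ->].
    rewrite memJ_norm ?(subsetP nLG) // Lu -conjXg -ux -!conjgM.
    rewrite (commgC y x) (conjgM _ (x * y)) [(_ ^ _) ^ [~ _, _]]conjgE.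
    have cR : [~ y, x] \in 'C(L).
      by apply: (subsetP cLW); apply: (subsetP (residual_der p G)); rewrite mem_commg.
    have Lw' : u ^ (x * y) \in L by rewrite memJ_norm // (subsetP nLG) ?groupM.
    by rewrite -(centP cR) ?mulKg ?eqxx.
  by move/setP/(_ v): eqE; rewrite inE Lv /= => /eqP.
have [v Lv ntv] := trivgPn _ ntL.
have <- : <[v]> = L.
  apply: minL'; last by rewrite cycle_subG.
  rewrite cycle_eq1 ntv; apply/subsetP=> x Gx; rewrite inE -cycleJ cycle_subG.
  by have [k ->] := expL x v Gx Lv; rewrite mem_cycle.
rewrite -orderE (abelem_order_p abL Lv ntv).
by have [] := pgroup_pdiv pL ntL.
Qed.

End Irreducible.

Section ChiefFactorPrime.

Variable gT : finGroupType.
Implicit Types (p : nat) (A B C D E G H K L M N P S T X Y : {group gT}).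

Lemma chief_factor_prime p G T P :
    chief_factor G T P -> p.-group (P / T) ->
    (forall x, x \in residual p G -> p^'.-elt x -> [~: P, <[x]>] \subset T) ->
  prime #|P : T|.
Proof.
move=> chT pPT stab; have minP := chief_factor_minnormal chT.
have [/maxgroupp/andP[/proper_sub sTP nTG] nsPG] := andP chT.
have [sPG nPG] := andP nsPG; have nTP := subset_trans sPG nTG.
have nsTG : T <| G by rewrite /normal nTG (subset_trans sTP).
rewrite -card_quotient //; apply: (@minnormal_prime _ p (G / T)).
- exact: minP.
- exact: quotientS.
- exact: pPT.
move=> xb; rewrite /= -residual_quotient // => /morphimP[x Nx Kx ->] p'x.
(* [x] may fail to be a [p']-element; its [p']-part has the same image and stays in the residual. *)
rewrite -(constt_p_elt p'x) -morph_constt // -cycle_subG -quotient_cycle ?groupX //.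
rewrite quotient_cents2r // commGC stab ?p_elt_constt //.
by rewrite /residual groupX.
Qed.

End ChiefFactorPrime.

(** * The partial Pi-property of p-subgroups *)

(* A and B need not bound a chief factor: for a p-subgroup H the index condition
   passes to refinements, and normal chains, unlike chief series, are mapped to
   normal chains by quotients. *)
Definition Pi_step (gT : finGroupType) p (G H A B : {group gT}) :=
  [/\ A <| G, B <| G, A \subset B & p.-nat #|G : 'N_G((H :&: B) <*> A)|].

Definition Pi_chain (gT : finGroupType) p (G H : {group gT}) :=
  chain (Pi_step p G H) 1%G G.

Section PiChain.

Variable gT : finGroupType.
Implicit Types (p : nat) (A B C D E G H K L M N P S T X Y : {group gT}).

(** By Dedekind's law the section in the definition is the image of [(H :&: B) <*> A]. It is a
    [p]-group, so its only possible prime divisor is [p], and its normaliser lifts to [G] with the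
    same index. *)
Lemma Pi_chain_of_partial p G H :
  p.-group H -> H \subset G -> partial_Pi_property H G -> Pi_chain p G H.
Proof.
move=> pH sHG [s chs lastG]; rewrite /Pi_chain.
suff chK Z : chain (fun A B => [rel A B : {group gT} | chief_factor G A B && Pi_index G H A B] A B) 1%G Z ->
    chain (Pi_step p G H) 1%G Z by apply: chK; rewrite -[X in chain _ _ X]lastG; apply: chain_path.
elim=> [|A B _ IH stepAB]; first exact: chain0.
apply: chainS IH _; case/andP: stepAB => /andP[maxA nsBG] piAB.
have /andP[/proper_sub sAB nAG] := maxgroupp maxA.
have nsAG : A <| G by rewrite /normal nAG (subset_trans sAB) ?normal_sub.
split=> //; have nAH : H :&: B \subset 'N(A).
  by rewrite subIset // (subset_trans sHG).
set K := (H :&: B) <*> A.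
have defS : (H * A) / A :&: B / A = K / A.
  rewrite -quotientIG // /K quotientYidr // -(quotientMidr A (H :&: B)).
  by rewrite [H :&: B]setIC group_modr // setIC.
have nsAK : A <| K by rewrite /normal joing_subr join_subG nAH normG.
have sKG : K \subset G by rewrite join_subG subIset ?sHG // normal_sub.
have pS : p.-group (K / A) by rewrite quotientYidr // quotient_pgroup // (pgroupS (subsetIl _ _)).
move: piAB; rewrite /Pi_index defS /= -quotient_subnormG //.
rewrite index_quotient_eq ?subsetIl //; last first.
  rewrite (subset_trans (subsetIr G A)) // subsetI normal_sub //=.
  exact: subset_trans (normal_sub nsAK) (normG _).
apply: sub_in_pnat => q _; rewrite inE mem_primes => /and3P[prq _ dvq].
by have /pgroupP/(_ q prq dvq) := pS.
Qed.

Lemma pnat_index_normal p G S Y :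
  p.-Sylow(G) S -> S \subset 'N(Y) -> p.-nat #|G : 'N_G(Y)| -> G \subset 'N(Y).
Proof.
case/and3P=> sSG _ p'iS nYS piN; apply/setIidPl/eqP.
rewrite eqEsubset subsetIl -indexg_eq1 /=.
have p'iN : p^'.-nat #|G : 'N_G(Y)|.
  by apply: pnat_dvd p'iS; rewrite indexgS // subsetI sSG.
by rewrite (pnat_1 piN p'iN).
Qed.

(** Any Sylow [p]-subgroup of [G] together with ['N_G(H)] covers [G], so a Sylow subgroup containing
    [H] is carried onto any other one by an element normalising [H]. *)
Lemma pnat_index_pcore p G H :
  p.-group H -> H \subset G -> p.-nat #|G : 'N_G(H)| -> H \subset 'O_p(G).
Proof.
move=> pH sHG piN; apply/bigcapsP => P; rewrite max_pgroup_Sylow => sylP.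
have [x Gx sHPx] := Sylow_subJ sylP sHG pH.
have sylPx : p.-Sylow(G) (P :^ x) by rewrite pHallJ.
have defG : (P :^ x) * 'N_G(H) = G.
  apply: coprime_index_mulG; rewrite ?subsetIl ?(pHall_sub sylPx) //.
  by rewrite coprime_sym (pnat_coprime piN); case/and3P: sylPx.
have: x^-1 \in (P :^ x) * 'N_G(H) by rewrite defG groupV.
case/mulsgP=> y n Py /setIP[_ nHn] def_x.
have <- : (P :^ x) :^ (y * n) = P by rewrite -def_x conjsgK.
by rewrite conjsgM (conjGid Py) -(normP nHn) conjSg.
Qed.

(** As [X :&: A = 1], Dedekind's law recovers [H :&: B] as the intersection of [(H :&: B) <*> A]
    with [X]. So whatever normalises that join also normalises [H :&: K]. *)
Lemma Pi_step_meet_bottom p G H X A B K :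
    H \subset X -> X <| G -> Pi_step p G H A B -> X :&: A = 1 ->
    K <| G -> K \subset X :&: B ->
  p.-nat #|G : 'N_G(H :&: K)|.
Proof.
move=> sHX nsXG [nsA nsB sAB piN] tiXA nsKG; rewrite subsetI => /andP[sKX sKB].
apply: pnat_dvd piN; apply: indexgS; rewrite subsetI subsetIl /=.
have -> : H :&: K = ((H :&: B) <*> A) :&: X :&: K.
  have nAH : H :&: B \subset 'N(A).
    rewrite subIset // (subset_trans _ (normal_norm nsA)) //.
    by rewrite (subset_trans sHX (normal_sub nsXG)).
  rewrite (norm_joinEl nAH).
  rewrite -group_modl; last by rewrite subIset ?sHX.
  by rewrite (setIC A) tiXA mulg1 -setIA (setIidPr sKB).
by rewrite !normsI ?subsetIr // (subset_trans (subsetIl _ _)) ?normal_norm.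
Qed.

(** Dually, [X :&: A \subset T] makes [H <*> T] the intersection of [H <*> A <*> T] with [X]. *)
Lemma Pi_step_join_top p G H X A B T :
    H \subset X -> X <| G -> Pi_step p G H A B -> X \subset B ->
    T <| G -> T \subset X -> X :&: A \subset T ->
  p.-nat #|G : 'N_G(H <*> T)|.
Proof.
move=> sHX nsXG [nsA nsB sAB piN] sXB nsTG sTX sXAT.
have sHG := subset_trans sHX (normal_sub nsXG).
have sTG := normal_sub nsTG.
apply: pnat_dvd piN; apply: indexgS; rewrite subsetI subsetIl /=.
rewrite (setIidPl (subset_trans sHX sXB)).
have -> : H <*> T = (H <*> A <*> T) :&: X.
  rewrite -joingA (joingC A) joingA (norm_joinEl (H := A)); last first.
    by rewrite (subset_trans _ (normal_norm nsA)) // join_subG sHG.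
  rewrite -group_modl; last by rewrite join_subG sHX.
  have s : X :&: A \subset H <*> T := subset_trans sXAT (joing_subr _ _).
  by rewrite [A :&: X]setIC (mulGSid s).
rewrite normsI //; last by rewrite (subset_trans (subsetIl _ _)) ?normal_norm.
by rewrite normsY ?subsetIr // (subset_trans (subsetIl _ _)) ?normal_norm.
Qed.

End PiChain.

Section PiQuotient.

Variable gT : finGroupType.
Implicit Types (p : nat) (A B C D E G H K L M N P S T X Y : {group gT}).

Lemma Pi_chain_quotient p G H N :
    N <| G -> H \subset G -> Pi_chain p G H ->
    (forall B, B <| G -> H / N :&: B / N = (H :&: B) / N) ->
  Pi_chain p (G / N) (H / N).
Proof.
move=> nsNG sHG chG HB; have nNG := normal_norm nsNG.
suff chK K : chain (Pi_step p G H) 1%G K ->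
    chain (Pi_step p (G / N) (H / N)) 1%G (K / N)%G by apply: chK.
elim=> [|A B _ IH [nsA nsB sAB piN]].
  by rewrite (_ : (1 / N)%G = 1%G) //; [exact: chain0 | apply/val_inj/quotient1].
apply: chainS IH _; split; rewrite ?quotient_normal ?quotientS //=.
have nNA : A \subset 'N(N) := subset_trans (normal_sub nsA) nNG.
have nNHB : H :&: B \subset 'N(N) by rewrite subIset // (subset_trans sHG).
rewrite HB // -quotientY //.
have piNq : p.-nat #|G / N : 'N_G((H :&: B) <*> A) / N|.
  by apply: pnat_dvd (index_quotient _) piN; rewrite subIset // nNG.
apply: pnat_dvd piNq; apply: indexgS.
by rewrite subsetI quotientS ?subsetIl ?quotient_norms ?subsetIr.
Qed.

Lemma Pi_chain_quotient_sub p G H N :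
    N <| G -> H \subset G -> N \subset H -> Pi_chain p G H ->
  Pi_chain p (G / N) (H / N).
Proof.
move=> nsNG sHG sNH chG; apply: Pi_chain_quotient => // B _.
by rewrite -quotientGI.
Qed.

(** An element of [H] lying in [N * B] is, modulo [B], both a [p]-element and a [p']-element, hence
    lies in [B]. *)
Lemma Pi_chain_quotient_coprime p G H N :
    N <| G -> H \subset G -> p.-group H -> p^'.-group N -> Pi_chain p G H ->
  Pi_chain p (G / N) (H / N).
Proof.
move=> nsNG sHG pH p'N chG; apply: Pi_chain_quotient => // B nsB.
apply/eqP; rewrite eqEsubset quotientI andbT.
have nNB : B \subset 'N(N) by rewrite (subset_trans (normal_sub nsB)) ?normal_norm.
have nBN : N \subset 'N(B) by rewrite (subset_trans (normal_sub nsNG)) ?normal_norm.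
apply/subsetP=> _ /setIP[/morphimP[h Nh Hh ->] Bh].
rewrite mem_quotient // inE Hh /=.
have {Bh} Bh : h \in N * B by rewrite -quotientK // inE Nh inE.
have nBh : h \in 'N(B) by rewrite (subsetP (normal_norm nsB)) ?(subsetP sHG).
suff h1 : coset B h = 1 by exact: coset_idr h1.
apply/eqP; rewrite -order_eq1; apply/eqP/(@pnat_1 p).
  exact: morph_p_elt (mem_p_elt pH Hh).
have: coset B h \in N / B.
  by case/mulsgP: Bh => n b Nn Bb ->; rewrite coset_kerr // mem_quotient.
by apply: mem_p_elt; apply: quotient_pgroup.
Qed.

End PiQuotient.

(** * Inheritance of quaternion-freeness *)

Section QuaternionFree.

Lemma quaternion_free_dec (gT : finGroupType) (P : {group gT}) :
  quaternion_free P \/ ~ quaternion_free P.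
Proof.
pose b := [forall H : {group gT}, forall K : {group gT},
  (H \subset P) ==> (K <| H) ==> ~~ (H / K \isog 'Q_8)].
have [/forallP q | /forallP nq] := boolP b; [left | right].
  by move=> H K sHP nsK; have /forallP/(_ K) := q H; rewrite sHP nsK.
by move=> q; apply: nq => H; apply/forallP=> K; do 2![apply/implyP=> ?]; apply: q.
Qed.

Lemma quaternion_free_sub (gT : finGroupType) (P R : {group gT}) :
  R \subset P -> quaternion_free P -> quaternion_free R.
Proof. by move=> sRP qP H K sHR; apply: qP; apply: subset_trans sRP. Qed.

Lemma quaternion_free_morphim (aT rT : finGroupType) (P : {group aT})
    (f : {morphism P >-> rT}) :
  quaternion_free P -> quaternion_free (f @* P).
Proof.
move=> qP H K sHfP nsKH; apply/negP=> isoHK.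
have nKH : f @*^-1 H \subset f @*^-1 'N(K) by rewrite morphpreS ?normal_norm.
pose g := [morphism of coset_morphism K \o f].
have isoH := first_isog_loc g nKH.
have /negP := qP (f @*^-1 H)%G ('ker_(f @*^-1 H) g)%G (subsetIl _ _)
  (normalGI nKH (ker_normal g)).
apply; apply: isog_trans isoH _.
by rewrite /g /= morphim_comp morphpreK.
Qed.

Lemma quaternion_free_isog (aT rT : finGroupType) (P : {group aT})
    (R : {group rT}) :
  P \isog R -> quaternion_free P -> quaternion_free R.
Proof.
case/isogP=> f _ eqR qP; have qfP := quaternion_free_morphim (f := f) qP.
by move=> H K sHR; apply: qfP; rewrite /= eqR.
Qed.

Lemma quaternion_free_quotient (gT : finGroupType) (P N : {group gT}) :
  P \subset 'N(N) -> quaternion_free P -> quaternion_free (P / N).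
Proof.
move=> nNP qP H K sHPN.
have := quaternion_free_morphim (f := restrm_morphism nNP (coset_morphism N)) qP.
by apply; rewrite /= morphim_restrm setIid.
Qed.

End QuaternionFree.

Definition maximal_chains (gT : finGroupType) p (G P : {group gT}) :=
  forall M : {group gT}, maximal M P -> Pi_chain p G M.

Definition cyclic_chains (gT : finGroupType) p (G P : {group gT}) :=
  forall C : {group gT}, C \subset P -> cyclic C ->
    #|C| = p \/ (#|C| = 4 /\ ~ quaternion_free P) -> Pi_chain p G C.

Section Chains.

Variable gT : finGroupType.
Implicit Types (p : nat) (A B C D E G H K L M N P S T X Y : {group gT}).

Lemma maximal_chainsP p G P :
  p.-group P -> P \subset G -> maximal_Pi G P -> maximal_chains p G P.
Proof.
move=> pP sPG maxP M maxM; have sMP := proper_sub (maxgroupp maxM).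
by apply: Pi_chain_of_partial (maxP M maxM); rewrite ?(pgroupS sMP) ?(subset_trans sMP).
Qed.

Lemma cyclic_chainsP p G P :
  prime p -> p.-group P -> P \subset G -> cyclic_Pi G P -> cyclic_chains p G P.
Proof.
move=> prp pP sPG cycP C sCP cycC oC.
apply: Pi_chain_of_partial; rewrite ?(pgroupS sCP) ?(subset_trans sCP) //.
by apply: cycP => //; case: oC => [->|]; [left | right].
Qed.

Lemma cyclic_chainsS p G P (R : {group gT}) :
  R \subset P -> cyclic_chains p G P -> cyclic_chains p G R.
Proof.
move=> sRP chP C sCR cycC oC; apply: chP (subset_trans sCR sRP) cycC _.
case: oC => [|[o4 nq]]; [by left | right; split=> // qP].
by apply: nq; apply: quaternion_free_sub qP.
Qed.

Lemma maximal_chains_quotient p G P N :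
    N <| G -> P \subset G -> p.-group P ->
    (N \subset P \/ p^'.-group N) ->
  maximal_chains p G P -> maximal_chains p (G / N) (P / N).
Proof.
move=> nsNG sPG pP hN chP M maxM; have nNP := subset_trans sPG (normal_norm nsNG).
have sMP := proper_sub (maxgroupp maxM).
have sMPN : M \subset coset N @* P := sMP.
pose f := restrm_morphism nNP (coset_morphism N).
have fP : f @* P = P / N by rewrite morphim_restrm setIid.
pose Q := (f @*^-1 M)%G.
have maxQ : maximal Q P.
  have fQ : (f @*^-1 (P / N))%G = P.
    by apply/val_inj; rewrite /= morphpre_restrm; apply/setIidPl; rewrite -sub_quotient_pre.
  by rewrite -[in X in maximal _ X]fQ morphpre_maximal ?fP.
have sQP := proper_sub (maxgroupp maxQ).
have -> : M = (Q / N)%G.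
  apply/val_inj; rewrite /= morphpre_restrm quotient_setIpre /=.
  by rewrite (setIidPr sMPN).
have sQG := subset_trans sQP sPG.
case: hN => [sNP | p'N]; last first.
  by apply: Pi_chain_quotient_coprime; rewrite ?(pgroupS sQP) //; apply: chP.
apply: Pi_chain_quotient_sub => //; last exact: chP.
by rewrite /= morphpre_restrm subsetI sNP sub_cosetpre.
Qed.

Lemma cyclic_chains_quotient p G P N :
    N <| G -> P \subset G -> p.-group P -> p^'.-group N ->
  cyclic_chains p G P -> cyclic_chains p (G / N) (P / N).
Proof.
move=> nsNG sPG pP p'N chP C sCP cycC oC.
have nNP := subset_trans sPG (normal_norm nsNG).
have tiNP : N :&: P = 1 by rewrite coprime_TIg // coprime_sym (pnat_coprime pP).
have isoP := quotient_isog nNP tiNP.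
have [Q defC sQP] : exists2 Q : {group gT}, C = (Q / N)%G & Q \subset P.
  exists (P :&: coset N @*^-1 C)%G; last exact: subsetIl.
  by apply/val_inj; rewrite /= quotient_setIpre (setIidPr sCP).
have isoQ : Q \isog Q / N.
  apply: quotient_isog; first exact: subset_trans sQP nNP.
  by apply/trivgP; rewrite -tiNP setIS.
rewrite defC; apply: Pi_chain_quotient_coprime; rewrite ?(pgroupS sQP) ?(subset_trans sQP) //.
apply: chP => //; first by rewrite (isog_cyclic isoQ); move: cycC; rewrite defC.
rewrite (card_isog isoQ); move: oC; rewrite defC /= => -[| [o4 nq]]; [by left | right; split=> //].
by move=> qP; apply: nq; apply: quaternion_free_isog qP.
Qed.

End Chains.

(** * Actions on [p]-groups detected by elements of order [p] or 4 *)

Section CoprimeAction.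

Variable gT : finGroupType.
Implicit Types (p : nat) (A B C D E G H K L M N P Q R S T X Y : {group gT}).

(** The relations make the group an image of ['Q_8]; it properly contains [<[x]>], so its order is a
    multiple of 4 exceeding 4. *)
Lemma isog_quaternion8 (x y : gT) :
    #[x] = 4 -> y ^+ 2 = x ^+ 2 -> x ^ y = x^-1 -> ~ commute x y ->
  <[x]> <*> <[y]> \isog 'Q_8.
Proof.
move=> ox y2 xy ncxy.
suff: (<[x]> <*> <[y]> \isog [set: 'Q_(2 ^ 3)]) by [].
rewrite isogEcard card_quaternion // Grp_quaternion //=; apply/andP; split.
  apply/existsP; exists (x, y); rewrite /= !xpair_eqE joing_idl joing_idr.
  by rewrite eqxx y2 xy !eqxx -[(2 ^ 2)%N]/4 -ox expg_order eqxx.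
have prx : <[x]> \proper <[x]> <*> <[y]>.
  rewrite properE joing_subl join_subG subxx /= cycle_subG.
  apply/negP=> yx; apply: ncxy; apply: (centsP (cycle_abelian x)) => //.
  exact: cycle_id.
have := proper_card prx; rewrite -orderE ox => lt4.
have /dvdnP[k] : 4 %| #|<[x]> <*> <[y]>| by rewrite -ox cardSg ?joing_subl.
by move=> ek; move: lt4; rewrite ek; case: k {ek} => [|[|k]].
Qed.

(* Without a subgroup Q_8 the elements of order 4 generate an abelian subgroup W.
   If W <> Q, every element outside W is an involution inverting W, whence
   #|Q : W| = 2 and [~: Q, A] \subset W. *)
Lemma quaternion_free_core Q A (z : gT) :
    #[z] = 2 -> z \in 'C(A) -> {in Q, forall x, x ^+ 2 \in <[z]>} ->
    {in Q &, forall x y, [~ x, y] \in <[z]>} -> A \subset 'N(Q) ->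
    [~: Q, A] = Q -> quaternion_free Q ->
  abelian Q.
Proof.
move=> oz cz sqz comz nQA defQ qfQ.
have zP t : t \in <[z]> -> t = 1 \/ t = z.
  by rewrite (cycle2g oz) !inE => /orP[] /eqP; [left | right].
have z2 : z ^+ 2 = 1 by rewrite -oz expg_order.
have ntz : z != 1 by rewrite -order_gt1 oz.
have o4 x : x \in Q -> x ^+ 2 = z -> #[x] = 4.
  move=> Qx x2; have x4 : x ^+ (2 ^ 2) = 1 by rewrite (expgM x 2 2) x2.
  have: #[x] %| 2 ^ 2 by rewrite order_dvdn x4.
  case/(dvdn_pfactor _ _ (isT : prime 2)) => [[|[|[|//]]] _ e].
  - move/eqP: e; rewrite expn0 order_eq1 => /eqP x1.
    by case/eqP: ntz; rewrite -x2 x1 expg1n.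
  - by move: ntz; rewrite -x2 -[2]/(2 ^ 1)%N -e expg_order eqxx.
  - exact: e.
pose W0 := [set x in Q | x ^+ 2 == z]; pose W := <<W0>>%G.
have sWQ : W \subset Q by rewrite gen_subG; apply/subsetP=> x; rewrite inE => /andP[].
have cW0 : {in W0 &, commutative mulg}.
  move=> x y /[!inE] /andP[Qx /eqP x2] /andP[Qy /eqP y2].
  apply/eqP; apply: contraT => /eqP nc.
  have cxy : [~ x, y] = z.
    case: (zP _ (comz _ _ Qx Qy)) => // /eqP /commgP.
    by [].
  have ox := o4 x Qx x2.
  have sHQ : <[x]> <*> <[y]> \subset Q by rewrite join_subG !cycle_subG Qx.
  have xy : x ^ y = x^-1.
    rewrite conjg_mulR cxy -x2; apply: (mulgI x); rewrite mulgV -expgS.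
    by rewrite -[RHS](expg_order x) ox expgS.
  have isoQ : <[x]> <*> <[y]> \isog 'Q_8.
    by apply: isog_quaternion8; rewrite ?x2 ?y2.
  have /negP[] := qfQ (<[x]> <*> <[y]>)%G 1%G sHQ (normal1 _).
  by apply: isog_trans isoQ; rewrite isog_sym quotient1_isog.
have cWW : abelian W.
  by rewrite abelian_gen; apply/centsP=> x Wx y Wy; apply: cW0.
have [eWQ | neWQ] := eqVneq (W : {set gT}) Q; first by rewrite -eWQ.
have prWQ : W \proper Q by rewrite properEneq neWQ.
have inv u w : u \in Q -> u \notin W -> w \in W -> w ^ u = w^-1.
  move=> Qu nWu Ww.
  have sq v : v \in Q -> v \notin W -> v ^+ 2 = 1.
    move=> Qv nWv; case: (zP _ (sqz _ Qv)) => // v2.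
    by case/negP: nWv; apply: mem_gen; rewrite inE Qv v2 eqxx.
  have Qw := subsetP sWQ w Ww.
  have u2 := sq u Qu nWu.
  have := sq (u * w) (groupM Qu Qw); rewrite groupMr // => /(_ nWu) uw2.
  have uV : u^-1 = u by apply: (mulgI u); rewrite mulgV -u2.
  rewrite conjgE uV; apply: (mulIg w); rewrite mulVg -uw2.
  by rewrite expgS expg1 !mulgA.
have [W01 | [w]] := set_0Vmem W0.
  have sq1 x : x \in Q -> x ^+ 2 = 1.
    move=> Qx; case: (zP _ (sqz _ Qx)) => // x2.
    by have: x \in W0; [rewrite inE Qx x2 eqxx | rewrite W01 inE].
  apply/centsP=> x Qx y Qy.
  have V t : t \in Q -> t^-1 = t.
    by move=> Qt; apply: (mulgI t); rewrite mulgV -(sq1 t Qt).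
  by rewrite /commute -[LHS]V ?groupM // invMg !V.
rewrite inE => /andP[Qw /eqP w2].
have Ww : w \in W by rewrite mem_gen // inE Qw w2 eqxx.
have wV : w^-1 != w.
  apply/eqP=> eqw; case/eqP: ntz; rewrite -w2.
  by rewrite expgS expg1 -{1}eqw mulVg.
(* The product of two elements inverting [W] fixes [w], whereas an element outside [W] would send
   [w] to [w^-1], which differs from [w]. *)
have quoW u v : u \in Q -> v \in Q -> u \notin W -> v \notin W -> u^-1 * v \in W.
  move=> Qu Qv nu nv; apply: contraR wV => nuv.
  have Quv : u^-1 * v \in Q by rewrite groupM ?groupV.
  rewrite -(inv _ _ Quv nuv Ww) conjgM (inv u^-1) ?groupV //.
  by rewrite (inv v) ?groupV // invgK.
have nWA : A \subset 'N(W).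
  apply/subsetP=> a Aa; have nQa := subsetP nQA a Aa.
  rewrite inE -genJ genS //.
  apply/subsetP=> _ /imsetP[x /[!inE] /andP[Qx /eqP x2] ->].
  by rewrite memJ_norm // Qx -conjXg x2 conjgE (centP cz _ Aa) mulKg eqxx.
have sQW : Q \subset W.
  rewrite -{1}defQ gen_subG; apply/subsetP=> _ /imset2P[x a Qx Aa ->].
  have nWa := subsetP nWA a Aa; have Qxa : x ^ a \in Q by rewrite memJ_norm ?(subsetP nQA).
  rewrite commgEl; have [Wx | nWx] := boolP (x \in W).
    by rewrite groupM ?groupV // memJ_norm.
  by rewrite quoW // memJ_norm.
by case/eqP: neWQ; apply/eqP; rewrite eqEsubset sWQ.
Qed.

End CoprimeAction.

Section CoprimeSmall.

Variable gT : finGroupType.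
Implicit Types (p : nat) (A B C D E G H K L M N P Q R S T X Y : {group gT}).

Section PowerMap.

Variables (p : nat) (P A T : {group gT}).
Hypotheses (pP : p.-group P) (nPA : A \subset 'N(P)) (defP : [~: P, A] = P).
Hypotheses (sTZ : T \subset 'Z(P)) (cTA : A \subset 'C(T)).
Hypothesis (sPhT : 'Phi(P) \subset T).

Let cT t x : t \in T -> x \in P -> commute t x.
Proof. by move=> Tt Px; have /setIP[_ /centP] := subsetP sTZ t Tt; apply. Qed.

Let sT x : x \in P -> x ^+ p \in T.
Proof.
move=> Px; apply: (subsetP sPhT); rewrite (Phi_joing pP).
apply: (subsetP (joing_subr _ _)); rewrite (MhoE 1 pP) mem_gen //.
by apply/imsetP; exists x.
Qed.

Let derT : {in P &, forall x y, [~ x, y] \in T}.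
Proof.
move=> x y Px Py; apply: (subsetP sPhT); rewrite (Phi_joing pP).
by apply: (subsetP (joing_subl _ _)); rewrite mem_commg.
Qed.

Let comX i : {in P &, forall x y, [~ x ^+ i, y] = [~ x, y] ^+ i}.
Proof. by move=> x y Px Py; rewrite commXg //; apply/commute_sym/cT/Px/derT. Qed.

Let comp : {in P &, forall x y, [~ x, y] ^+ p = 1}.
Proof. by move=> x y Px Py; rewrite -comX //; apply/eqP/commgP/cT/Py/sT. Qed.

(* P has class at most 2, so x |-> x ^ m is a morphism, and it kills [~ x, a]. *)
Lemma power_map_trivial m :
    p %| m -> {in P &, forall x y, [~ x, y] ^+ 'C(m, 2) = 1} ->
  {in P, forall x, x ^+ m = 1}.
Proof.
move=> dvm com1; have powM : {in P &, forall x y, (x * y) ^+ m = x ^+ m * y ^+ m}.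
  move=> x y Px Py; rewrite expMg_Rmul ?com1 ?mulg1 //.
    by apply/commute_sym/cT/Py/derT.
  by apply/commute_sym/cT/Px/derT.
have gE : group_set [set x in P | x ^+ m == 1].
  apply/group_setP; split=> [|x y]; rewrite !inE ?group1 ?expg1n ?eqxx //.
  case/andP=> Px /eqP xm /andP[Py /eqP ym].
  by rewrite groupM //= powM // xm ym mulg1.
suff sPE : P \subset Group gE by move=> x /(subsetP sPE); rewrite inE => /andP[_ /eqP].
rewrite -{1}defP gen_subG; apply/subsetP=> _ /imset2P[x a Px Aa ->].
have Pxa : x ^ a \in P by rewrite memJ_norm ?(subsetP nPA).
rewrite inE commgEl groupM ?groupV //= powM ?groupV // -conjXg.
have Tm : x ^+ m \in T by case/dvdnP: dvm => k ->; rewrite mulnC expgM groupX ?sT.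
by rewrite conjgE -(centP (subsetP cTA a Aa)) // mulKg expgVn mulVg.
Qed.

Lemma exponent_odd : prime p -> odd p -> {in P, forall x, x ^+ p = 1}.
Proof.
move=> prp odp; apply: power_map_trivial => // x y Px Py.
have /dvdnP[k ->] : p %| 'C(p, 2) by rewrite prime_dvd_bin //= odd_prime_gt2.
by rewrite mulnC expgM comp // expg1n.
Qed.

(** Squaring need not be a morphism, because ['C(2, 2) = 1] does not kill commutators, but
    ['C(4, 2) = 6] does. This is where elements of order 4 come in. *)
Lemma exponent_dvd4 : p = 2 -> {in P, forall x, x ^+ 4 = 1}.
Proof.
move=> p2; apply: power_map_trivial => [|x y Px Py]; first by rewrite p2.
have -> : 'C(4, 2) = (p * 3)%N by rewrite p2.
by rewrite expgM comp // expg1n.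
Qed.

Lemma quaternion_free_abelian : p = 2 -> quaternion_free P -> abelian P.
Proof.
move=> p2 qP; apply: contraT => nabP.
have sTP : T \subset P := subset_trans sTZ (center_sub P).
have abTT : abelian T by exact: abelianS sTZ (center_abelian P).
have abelPhi : p.-abelem 'Phi(P).
  rewrite abelemE ?p2 // (abelianS sPhT) //=.
  rewrite (Phi_joing pP) -p2 (MhoE 1 pP); apply/exponentP=> t.
  have gE : group_set [set x in T | x ^+ 2 == 1].
    apply/group_setP; split=> [|x y]; rewrite !inE ?group1 ?expg1n ?eqxx //.
    case/andP=> Tx /eqP x2 /andP[Ty /eqP y2]; rewrite groupM //= expgMn ?x2 ?y2 ?mulg1 //.
    by apply: (centsP abTT).
  have : P^`(1) <*> <<[set x ^+ (p ^ 1) | x in P]>> \subset Group gE.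
    rewrite join_subG !gen_subG; apply/andP; split.
      apply/subsetP=> _ /imset2P[x y Px Py ->].
      by rewrite inE derT //= -p2 comp.
    apply/subsetP=> _ /imsetP[x Px ->]; rewrite inE expn1 sT //= -p2 -expgM.
    by rewrite p2 exponent_dvd4.
  by move/subsetP=> sub /sub; rewrite inE p2 => /andP[_ /eqP].
have [z Pz ntz] : exists2 z, z \in P^`(1) & z != 1.
  by apply/trivgPn; apply: contra nabP => /eqP/commG1P.
have Phz : z \in 'Phi(P) by rewrite (Phi_joing pP) (subsetP (joing_subl _ _)).
have oz : #[z] = p by apply: abelem_order_p Phz ntz.
have szPh : <[z]>%G \subset 'Phi(P) by rewrite cycle_subG.
have [U /dprodP[_ defPh _ tizU]] := abelem_split_dprod abelPhi szPh.
have sUT : U \subset T by rewrite (subset_trans _ sPhT) // -defPh mulG_subr.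
have nUP : P \subset 'N(U).
  by rewrite cents_norm // centsC (subset_trans sUT) // (subset_trans sTZ) ?subsetIr.
have nUA : A \subset 'N(U) by rewrite cents_norm // (subset_trans cTA) ?centS.
have nzU : z \notin U.
  apply: contra ntz => Uz; rewrite -cycle_eq1 -subG1 -tizU subsetI subxx cycle_subG //.
have Pz' : z \in P by rewrite (subsetP (der_sub 1 P)).
have PhU t : t \in 'Phi(P) -> coset U t \in <[coset U z]>.
  rewrite -defPh => /mulsgP[c u zc Uu ->]; rewrite coset_kerr //.
  by case/cycleP: zc => k ->; rewrite morphX ?(subsetP nUP) ?mem_cycle.
have ozb : #[coset U z] = 2.
  apply: nt_prime_order => //; last first.
    by apply: contra nzU => /eqP; apply: coset_idr; rewrite (subsetP nUP).
  by rewrite -morphX ?(subsetP nUP) //= -p2 -oz expg_order morph1.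
have abPU : abelian (P / U).
  apply: (@quaternion_free_core _ (P / U)%G (A / U)%G (coset U z)) => //=.
  - have : <[z]> / U \subset 'C(A / U).
      by rewrite quotient_cents // centsC (subset_trans cTA) // centS // cycle_subG (subsetP sPhT).
    by move/subsetP; apply; rewrite mem_quotient ?cycle_id.
  - move=> _ /morphimP[x Nx Px ->]; rewrite -morphX //= PhU //.
    rewrite (Phi_joing pP) (subsetP (joing_subr _ _)) // (MhoE 1 pP) mem_gen //.
    by apply/imsetP; exists x; rewrite ?p2.
  - move=> _ _ /morphimP[x Nx Px ->] /morphimP[y Ny Py ->]; rewrite -morphR //= PhU //.
    by rewrite (Phi_joing pP) (subsetP (joing_subl _ _)) // mem_commg.
  - exact: quotient_norms.
  - by rewrite -quotientR // defP.
  - exact: quaternion_free_quotient.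
by case/negP: nzU; apply: (subsetP (der1_min nUP abPU)).
Qed.

(** When [p = 2] and [P] is quaternion-free, [P] is abelian, so squaring is a morphism after all.
    Applied with [A] generated by one [p']-element and with [A] the centraliser of a normal
    subgroup. *)
Lemma exponent_small x :
    prime p -> x \in P -> x != 1 ->
  #[x] = p \/ (#[x] = 4 /\ ~ quaternion_free P).
Proof.
move=> prp Px ntx; have [odp | /eqP] := boolP (odd p).
  by left; apply: nt_prime_order => //; apply: exponent_odd.
have [p2 _ | odp] := even_prime prp; last by rewrite odp.
have [qP | nqP] := quaternion_free_dec P.
  left; apply: nt_prime_order => //; apply: (power_map_trivial _ _ Px) => // y z Py Pz.
  have /centsP cPP := quaternion_free_abelian p2 qP.
  by have /commgP/eqP-> : commute y z by [apply: cPP]; rewrite expg1n.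
have: #[x] %| 2 ^ 2 by rewrite order_dvdn exponent_dvd4.
case/(dvdn_pfactor _ _ (isT : prime 2)) => [[|[|[|//]]] _ e].
- by move: ntx; rewrite -order_eq1 e.
- by left; rewrite e p2.
- by right.
Qed.

End PowerMap.

(** By induction [a] centralises every proper [a]-invariant subgroup. If [[~: R, <[a]>]] is proper,
    [a] stabilises a chain of length two, hence acts trivially. Otherwise [a] centralises ['Phi(R)],
    and the three subgroups lemma makes ['Phi(R)] central in [R = [~: R, <[a]>]]; then every
    nontrivial element of [R] has one of the orders tested. *)
Lemma pelt_cent_of_small p R (a : gT) :
    prime p -> p.-group R -> p^'.-elt a -> a \in 'N(R) ->
    {in R, forall x, #[x] = p \/ (#[x] = 4 /\ ~ quaternion_free R) ->
      x \in 'C[a]} ->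
  a \in 'C(R).
Proof.
move=> prp; have [n] := ubnP #|R|; elim: n R => // n IHn R ltRn pR p'a nRa small.
have nRA : <[a]> \subset 'N(R) by rewrite cycle_subG.
have IH S : S \proper R -> a \in 'N(S) -> a \in 'C(S).
  move=> prS nSa; have sSR := proper_sub prS; apply: IHn => //.
  - by rewrite -ltnS (leq_trans _ ltRn) // ltnS proper_card.
  - exact: pgroupS pR.
  move=> x Sx ox; apply: small; first exact: (subsetP sSR).
  case: ox => [|[o4 nq]]; [by left | right; split=> // qR].
  by apply: nq; apply: quaternion_free_sub qR.
have sRaR : [~: R, <[a]>] \subset R by rewrite commg_subl.
have nRaA : <[a]> \subset 'N([~: R, <[a]>]) := commg_normr _ _.
have [eqR | neR] := eqVneq [~: R, <[a]>] R; last first.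
  apply: (@coprime_stab_cent _ R [~: R, <[a]>]%G a p) => //.
  - by rewrite /normal sRaR commg_norml.
  - by rewrite -cycle_subG.
  by apply: IH; [rewrite properEneq neR | rewrite -cycle_subG].
have [R1 | ntR] := eqVneq (R : {set gT}) 1; first by rewrite R1 cent1T inE.
have nPha : <[a]> \subset 'N('Phi(R)) := char_norm_trans (Phi_char R) nRA.
have cPha : a \in 'C('Phi(R)) by apply: IH; rewrite ?Phi_proper // -cycle_subG.
have cPhA : <[a]> \subset 'C('Phi(R)) by rewrite cycle_subG.
have sPhZ : 'Phi(R) \subset 'Z(R).
  rewrite subsetI Phi_sub /=; apply/commG1P; rewrite commGC -{1}eqR commGC.
  rewrite commGC [[~: R, _]]commGC.
  apply: three_subgroup.
    by apply/commG1P; rewrite centsC (subset_trans cPhA) // centS // commg_subr gFnorm.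
  have cAPh : 'Phi(R) \subset 'C(<[a]>) by rewrite centsC.
  by rewrite /= (commG1P cAPh) comm1G.
have smallR := exponent_small pR nRA eqR sPhZ cPhA (subxx _) prp.
suff sRC : R \subset 'C[a] by rewrite -sub_cent1 -cent_set1 centsC sub1set in sRC *.
apply/subsetP=> x Rx; have [-> | ntx] := eqVneq x 1; first exact: group1.
by apply: small => //; apply: smallR.
Qed.

End CoprimeSmall.

(** * Transfer, fusion and the focal subgroup *)

Section Fusion.

Variable gT : finGroupType.
Implicit Types (p : nat) (A B C D E G H K L M N P Q R S T X Y U V : {group gT}).

(** Under the fusion hypothesis the transfer of [X] into [S / S^](1)[sends]g[in]S[to the image of]g
    ^+ #|X : S|[. It kills]X^[(1)], and the index is prime to [p]. *)
Lemma focal_of_fusion p X S :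
    p.-Sylow(X) S ->
    (forall x g, x \in S -> g \in X -> x ^ g \in S ->
       exists2 u, u \in S & x ^ g = x ^ u) ->
  S :&: X^`(1) \subset S^`(1).
Proof.
move=> sylS fus; have [sSX pS p'iS] := and3P sylS.
pose alpha := restrm_morphism (der_norm 1 S) (coset_morphism S^`(1)).
have abA : abelian (alpha @* S).
  by rewrite /alpha /= morphim_restrm setIid; apply: sub_der1_abelian.
pose tau := transfer X abA.
have sX'K : X^`(1) \subset 'ker (transfer_morphism X abA).
  rewrite gen_subG; apply/subsetP=> _ /imset2P[x y Xx Xy ->].
  apply/kerP; first by rewrite groupR.
  rewrite morphR //; apply/eqP/commgP; exact: GRing.addrC.
apply/subsetP=> g /setIP[Sg X'g]; have Xg := subsetP sSX g Sg.
have tau0 : tau g = 0%R by apply: (kerP _ Xg); apply: (subsetP sX'K).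
have trX := transversalP (rcosets_cycle_partition sSX Xg).
move: tau0; rewrite /tau (transfer_cycle_expansion sSX abA Xg trX).
rewrite (eq_bigr (fun x => FiniteModule.fmod abA (alpha g) *+ #|<[g]> : S :* x|)%R).
  rewrite GRing.sumrMnr (sum_index_rcosets_cycle sSX Xg trX) => /(congr1 val).
  rewrite FiniteModule.fmvalZ /= FiniteModule.fmodK ?mem_morphim // => /eqP.
  rewrite -order_dvdn => dvo.
  have Ng : g \in 'N(S^`(1)) by rewrite (subsetP (der_norm 1 S)).
  apply: coset_idr => //; apply/eqP; rewrite -order_eq1; apply/eqP/(@pnat_1 p).
    exact: morph_p_elt (mem_p_elt pS Sg).
  exact: pnat_dvd dvo p'iS.
move=> x trx; set n := #|_ : _|.
have Xx : x \in X by apply: (subsetP (transversal_sub trX)).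
have Sy : (g ^+ n) ^ x^-1 \in S.
  by rewrite conjgE invgK mulgA -mem_rcoset mulg_exp_card_rcosets.
have [||u Su ->] := fus (g ^+ n) x^-1 _ _ Sy; rewrite ?groupX ?groupV //.
rewrite -FiniteModule.fmodX ?mem_morphim //= -morphX //=.
congr (FiniteModule.fmod abA _).
have cuy : commute (alpha u) (alpha (g ^+ n)).
  by apply: (centsP abA); rewrite mem_morphim ?groupX.
change (alpha ((g ^+ n) ^ u) = alpha (g ^+ n)).
by rewrite morphJ ?groupX // conjgE -cuy mulKg.
Qed.

(* Induction on the index of S :&: T, as in the proof of Frobenius' criterion. *)
Lemma Sylow_conj_cent p X :
    (forall R a, R \subset X -> p.-group R -> a \in 'N_X(R) -> p^'.-elt a ->
       a \in 'C(R)) ->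
  forall S T, p.-Sylow(X) S -> p.-Sylow(X) T ->
  exists2 c, c \in 'C_X(S :&: T) & T :=: S :^ c.
Proof.
move=> p'cent S T; have [n] := ubnP (#|X| - #|S :&: T|).
elim: n S T => // n IHn S T ltn sylS sylT.
have [sSX pS _] := and3P sylS; have [sTX pT _] := and3P sylT.
have [sST | nsST] := boolP (S \subset T).
  exists 1; rewrite ?group1 // conjsg1; apply/eqP; rewrite eq_sym eqEcard sST.
  by rewrite (card_Hall sylS) (card_Hall sylT) leqnn.
have oST : #|S| = #|T| by rewrite (card_Hall sylS) (card_Hall sylT).
pose D := (S :&: T)%G; have sDS : D \subset S := subsetIl _ _.
have sDT : D \subset T := subsetIr _ _.
have prDS : D \proper S.
  by rewrite properE sDS subsetI subxx (negPf nsST).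
have prDT : D \proper T by rewrite properEcard sDT -oST proper_card.
have grow S1 T1 : p.-Sylow(X) S1 -> p.-Sylow(X) T1 -> D \proper S1 :&: T1 ->
    exists2 c, c \in 'C_X(D) & T1 :=: S1 :^ c.
  move=> syl1 syl2 prD; have [|c /setIP[Xc cc] eqT1] := IHn S1 T1 _ syl1 syl2.
    rewrite -ltnS (leq_trans _ ltn) // ltnS ltn_sub2l ?proper_card //.
    exact: proper_sub_trans prDS sSX.
  by exists c => //; rewrite inE Xc (subsetP (centS (proper_sub prD))).
have sNX : 'N_X(D) \subset X := subsetIl _ _.
have [U sylU sSU] : {U : {group gT} | p.-Sylow('N_X(D)) U & 'N_S(D) \subset U}.
  by apply: Sylow_superset; rewrite ?setSI // (pgroupS (subsetIl _ _)).
have [V sylV sTV] : {V : {group gT} | p.-Sylow('N_X(D)) V & 'N_T(D) \subset V}.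
  by apply: Sylow_superset; rewrite ?setSI // (pgroupS (subsetIl _ _)).
have [sUN pU _] := and3P sylU; have [sVN pV _] := and3P sylV.
(* The hypothesis on [p']-elements makes ['N_X(D) / 'C_X(D)] a [p]-group, so Sylow subgroups of
   ['N_X(D)] are conjugate under ['C_X(D)]. *)
have defN : U * 'C_X(D) = 'N_X(D).
  have sCN : 'C_X(D) \subset 'N_X(D) by rewrite setIS ?cent_sub.
  apply: coprime_index_mulG => //.
  rewrite (@pnat_coprime p^') //; first by case/and3P: sylU.
  have nC : 'N_X(D) \subset 'N('C_X(D)).
    by rewrite normsI ?norms_cent ?subsetIr // (subset_trans (subsetIl _ _)) ?normG.
  rewrite pnatNK -card_quotient //.
  apply: pquotient_of_elts => // x Nx p'x.
  rewrite inE (subsetP sNX) //=; apply: p'cent => //.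
    exact: subset_trans sSX.
  exact: pgroupS pS.
have [m Nm eqV] := Sylow_trans sylU sylV.
have [c Cc defV] : exists2 c, c \in 'C_X(D) & V :=: U :^ c.
  have {}Nm : m \in U * 'C_X(D) by rewrite defN.
  case/mulsgP: Nm eqV => u c Uu Cc -> eqV.
  by exists c; rewrite // eqV conjsgM conjGid.
have Xc : c \in X by case/setIP: Cc.
(* Normalisers grow in [p]-groups: [S] and [S1] share ['N_S(D)], and [S1 :^ c] and [T] share
   ['N_T(D)], both larger than [D], so induction applies to each pair. *)
have [S1 sylS1 sUS1] := Sylow_superset (subset_trans sUN sNX) pU.
have [|c1 Cc1 eqS1] := grow S S1 sylS sylS1.
  apply: proper_sub_trans (nilpotent_proper_norm (pgroup_nil pS) prDS) _.
  by rewrite subsetI subsetIl (subset_trans sSU).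
have sylS1c : p.-Sylow(X) (S1 :^ c) by rewrite pHallJ.
have [|c2 Cc2 eqT] := grow (S1 :^ c)%G T sylS1c sylT.
  apply: proper_sub_trans (nilpotent_proper_norm (pgroup_nil pT) prDT) _.
  by rewrite subsetI subsetIl (subset_trans sTV) // defV conjSg.
exists (c1 * c * c2); first by rewrite !groupM.
by rewrite !conjsgM -eqS1 eqT.
Qed.

(** If [x] and [x ^ g] lie in [S], then [S :^ g] is carried back to [S] by some [c] centralising
    [x ^ g]. So [g * c] normalises [S], and ['N_X(S) = S * 'C_X(S)] shows that an element of [S]
    already fuses them. *)
Lemma focal_of_cent p X S :
    p.-Sylow(X) S ->
    (forall R a, R \subset X -> p.-group R -> a \in 'N_X(R) -> p^'.-elt a ->
       a \in 'C(R)) ->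
  S :&: X^`(1) \subset S^`(1).
Proof.
move=> sylS p'cent; have [sSX pS p'iS] := and3P sylS.
apply: (focal_of_fusion sylS) => x g Sx Xg Sxg.
have sylSg : p.-Sylow(X) (S :^ g) by rewrite pHallJ.
have [c /setIP[Xc cc] eqS] := Sylow_conj_cent p'cent sylSg sylS.
have xgc : (x ^ g) ^ c = x ^ g.
  have : x ^ g \in (S :^ g)%G :&: S by rewrite inE memJ_conjg Sx.
  by move=> Ixg; rewrite (conjgE (x ^ g)) -(centP cc _ Ixg) mulKg.
have nSgc : g * c \in 'N_X(S).
  by rewrite inE groupM //= inE conjsgM -eqS.
have defN : S * 'C_X(S) = 'N_X(S).
  have sCN : 'C_X(S) \subset 'N_X(S) by rewrite setIS ?cent_sub.
  apply: coprime_index_mulG => //; first by rewrite subsetI sSX normG.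
  rewrite (@pnat_coprime p^') //.
    by apply: pnat_dvd p'iS; rewrite indexSg ?subsetIl // subsetI sSX normG.
  have nC : 'N_X(S) \subset 'N('C_X(S)).
    by rewrite normsI ?norms_cent ?subsetIr // (subset_trans (subsetIl _ _)) ?normG.
  rewrite pnatNK -card_quotient //.
  apply: pquotient_of_elts => // y Ny p'y.
  by rewrite inE (subsetP (subsetIl _ _) _ Ny) /=; apply: p'cent.
move: nSgc; rewrite -defN => /mulsgP[u v Su /setIP[_ cv] gc].
exists u => //; rewrite -xgc -conjgM gc conjgM.
have Sxu : x ^ u \in S by rewrite groupJ.
by rewrite (conjgE (x ^ u)) -(centP cv _ Sxu) mulKg.
Qed.

End Fusion.

(** * Normal [p]-subgroups satisfying one of the two conditions *)

Section NormalPgroup.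

Variable gT : finGroupType.
Implicit Types (p : nat) (A B C D E G H K L M N P Q R S T X Y : {group gT}).

Lemma minnormal_normal G L X : minnormal L G -> L \subset X -> X \subset G -> L <| G.
Proof.
case/mingroupP=> /andP[_ nLG] _ sLX sXG.
by rewrite /normal nLG (subset_trans sLX).
Qed.

Lemma Sylow_normal_meet p G X P :
    X <| G -> p.-Sylow(X) P ->
  exists S : {group gT}, [/\ p.-Sylow(G) S, P \subset S & P :=: S :&: X].
Proof.
move=> nsXG sylP; have [sPX pP _] := and3P sylP.
have [S sylS sPS] := Sylow_superset (subset_trans sPX (normal_sub nsXG)) pP.
exists S; split=> //; symmetry; apply: sub_pHall sylP _ _ _.
- exact: pgroupS (subsetIl _ _) (pHall_pgroup sylS).
- by rewrite subsetI sPS.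
exact: subsetIr.
Qed.

(* A maximal subgroup M of P with M :&: L of index p in L and normalised by a
   Sylow p-subgroup of G has M :&: L normal in G, hence trivial. *)
Lemma minnormal_maximal_prime p G X P L :
    X <| G -> p.-Sylow(X) P -> minnormal L G -> L \subset P ->
    (forall K, minnormal K G -> K \subset X -> K :=: L) ->
    ~~ (L \subset 'Phi(P)) -> maximal_chains p G P ->
  prime #|L|.
Proof.
move=> nsXG sylP minL sLP uniqL nLPh chP; have [sPX pP _] := and3P sylP.
have sXG := normal_sub nsXG; have sLX := subset_trans sLP sPX.
have nsLG := minnormal_normal minL sLX sXG.
have [S [sylS sPS defP]] := Sylow_normal_meet nsXG sylP.
have [sSG pS _] := and3P sylS.
have nPS : S \subset 'N(P).
  by rewrite defP normsI ?normG // (subset_trans sSG) ?normal_norm.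
have nPhS : S \subset 'N('Phi(P)) := char_norm_trans (Phi_char P) nPS.
have nLS : S \subset 'N(L) := subset_trans sSG (normal_norm nsLG).
pose Z := (L :&: 'Phi(P))%G; have nZS : S \subset 'N(Z) by apply: normsI.
have sZL : Z \subset L := subsetIl _ _.
have nZL : L \subset 'N(Z) := subset_trans sLP (subset_trans sPS nZS).
have pL : p.-group L := pgroupS sLP pP.
have ntLZ : L / Z != 1.
  rewrite -subG1 quotient_sub1 //; apply: contra nLPh => sLZ.
  exact: subset_trans sLZ (subsetIr _ _).
have prp : prime p by have [] := pgroup_pdiv (quotient_pgroup Z pL) ntLZ.
have nsLZ : L / Z <| S / Z.
  by rewrite /normal quotientS ?(subset_trans sLP) // quotient_norms.
have [Qb [sQL nsQS oQ]] := normal_pgroup (quotient_pgroup Z pS) nsLZ (leq_pred (logn p #|L / Z|)).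
have nsZS : Z <| S by rewrite /normal nZS (subset_trans sZL) // (subset_trans sLP).
have [L1 defQ sZL1 nsL1S] := inv_quotientN nsZS nsQS.
have sL1L : L1 \subset L.
  by rewrite -(quotientSGK _ sZL) -?defQ // (subset_trans (normal_sub nsL1S)).
have iL1 : #|L : L1| = p.
  rewrite -(@index_quotient_eq _ L Z L1) ?(subset_trans (subsetIr L Z)) //.
  rewrite -divgS ?quotientS //= -defQ oQ.
  have oLZ : #|L / Z| = (p ^ logn p #|L / Z|)%N := card_pgroup (quotient_pgroup Z pL).
  have: 0 < logn p #|L / Z|.
    by rewrite lt0n; apply: contra ntLZ => /eqP k0; rewrite trivg_card1 oLZ k0.
  move: oLZ; move: (logn p #|L / Z|) => [//|k] -> _; by rewrite expnS mulnK ?expn_gt0 ?prime_gt0.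
have prL1L : L1 \proper L.
  rewrite properE sL1L; apply/negP=> sLL1.
  by move: prp; rewrite -iL1 (eqP (_ : #|L : L1| == 1%N)) // indexg_eq1.
pose N := (L1 <*> 'Phi(P))%G; have nL1P : P \subset 'N(L1).
  by rewrite (subset_trans sPS) ?normal_norm.
have nNP : P \subset 'N(N) by rewrite normsY // gFnorm.
have sNP : N \subset P by rewrite join_subG (subset_trans sL1L) ?Phi_sub.
(* [L1] was chosen above [Z = L :&: 'Phi(P)], so Dedekind's law gives [L :&: N = L1]. As [P / N] has
   trivial Frattini subgroup, some maximal subgroup of [P] then contains [N] but not [L]. *)
have nsLN : ~~ (L \subset N).
  apply: contra (proper_subn prL1L) => sLN.
  rewrite -(setIidPr sLN) /= norm_joinEr; last exact: subset_trans (Phi_sub P) nL1P.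
  by rewrite -group_modl // mul_subG // setIC.
have [M maxM [nLM sNM]] : exists2 M : {group gT}, maximal M P & ~~ (L \subset M) /\ N \subset M.
  have ntLN : ~~ (L / N \subset 'Phi(P / N)).
    rewrite -(quotient_Phi pP nNP) (_ : 'Phi(P) / N = 1); last first.
      by apply/trivgP; rewrite quotient_sub1 ?joing_subr // (subset_trans (Phi_sub P)).
    by rewrite quotient_sub1 // (subset_trans sLP).
  have [Mb maxMb nLMb] : exists2 Mb : {group coset_of N}, maximal_eq Mb (P / N) & ~~ (L / N \subset Mb).
    have /exists_inP[Mb maxMb nLMb] : [exists (Mb : {group coset_of N} | maximal_eq Mb (P / N)), ~~ (L / N \subset Mb)].
      apply: contraR ntLN; rewrite negb_exists => /forallP allM.
      apply/bigcapsP=> Mb maxMb; have := allM Mb.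
      by rewrite maxMb negbK.
    by exists Mb.
  have maxM : maximal Mb (P / N).
    case/orP: maxMb => // /eqP eqMb.
    by rewrite eqMb quotientS in nLMb.
  exists (coset N @*^-1 Mb)%G.
    have := cosetpre_maximal Mb (P / N)%G; rewrite maxM.
    by rewrite /= quotientGK // /normal sNP.
  split; last by rewrite sub_cosetpre.
  by apply: contra nLMb => sLM; rewrite sub_quotient_pre // (subset_trans sLP).
have sMP := proper_sub (maxgroupp maxM).
have defL1 : M :&: L = L1.
  have sL1M : L1 \subset M :&: L by rewrite subsetI sL1L (subset_trans (joing_subl _ _) sNM).
  apply/eqP; rewrite eqEsubset sL1M andbT -indexg_eq1.
  have dv : (#|L : M :&: L| * #|M :&: L : L1|)%N = p.
    by rewrite -iL1 Lagrange_index ?subsetIr.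
  have dvp : #|L : M :&: L| %| p by rewrite -[X in _ %| X]dv dvdn_mulr.
  have /primeP[_ /(_ _ dvp)/orP[/eqP i1 | /eqP ip]] := prp.
    by case/negP: nLM; rewrite (subset_trans _ (subsetIl M L)) // -indexg_eq1 i1.
  by move/eqP: dv; rewrite ip -{2}[p]muln1 eqn_pmul2l ?prime_gt0.
have [||A [B [stepAB tiXA ntXB]]] :=
  chain_jump (P := [pred Y : {group gT} | X :&: Y != 1]) (chP M maxM).
- by rewrite /= (setIidPr (sub1G X)) eqxx.
- rewrite /= (setIidPl sXG); apply: contraNneq nLPh => X1.
  by rewrite (subset_trans sLX) // X1 sub1G.
have {}tiXA : X :&: A = 1 by apply/eqP; move: tiXA; rewrite /= negbK.
have [nsA nsB _ _] := stepAB.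
have [K minK sKXB] := minnormal_exists ntXB (normal_norm (normalI nsXG nsB)).
have defK : K :=: L by apply: uniqL => //; rewrite (subset_trans sKXB) ?subsetIl.
rewrite defK in sKXB.
have sMX := subset_trans sMP sPX.
have := Pi_step_meet_bottom sMX nsXG stepAB tiXA nsLG sKXB.
rewrite defL1 => /(pnat_index_normal sylS (normal_norm nsL1S)) nL1G.
have L1_1 : L1 :=: 1.
  have [_ minL'] := mingroupP minL; apply/eqP; apply: contraT => ntL1.
  by case/eqP: (proper_neq prL1L); apply: minL'; rewrite ?ntL1.
by rewrite -indexg1 -L1_1 iL1.
Qed.

End NormalPgroup.

Section NormalPgroupHypercyclic.

(** By induction only a minimal normal subgroup [L] below [P] has to be shown of prime order. If
    there is another one, [L] embeds in the quotient by it. If [L] is unique and outside ['Phi(P)],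
    the previous lemma applies. If [L \subset 'Phi(P)], the [p']-elements of the residual centralise
    [P / L], hence [P / 'Phi(P)], hence [P]. *)
Lemma normal_maximal_hypercyclic (p : nat) (gT : finGroupType) (G P : {group gT}) :
  P <| G -> p.-group P -> maximal_chains p G P -> hypercyclic G 1 P.
Proof.
have [n] := ubnP #|P|; elim: n => // n IHn in gT G P * => ltPn nsPG pP chP.
have [sPG nPG] := andP nsPG.
have [P1 | ntP] := eqVneq (P : {set gT}) 1.
  by rewrite (_ : P = 1%G); [exact: chain0 | exact: val_inj].
have hypK (K : {group gT}) : minnormal K G -> K \subset P -> hypercyclic G K P.
  move=> minK sKP; have nsKG := minnormal_normal minK sKP sPG.
  apply: hypercyclic_quotient => //; apply: IHn.
  - rewrite -ltnS (leq_trans _ ltPn) // ltnS ltn_quotient //.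
    by have /mingroupP[/andP[]] := minK.
  - exact: quotient_normal.
  - exact: quotient_pgroup.
  by apply: maximal_chains_quotient; rewrite //; left.
have [L minL sLP] := minnormal_exists ntP nPG.
have nsLG := minnormal_normal minL sLP sPG.
suff prL : prime #|L|.
  apply: chain_trans (hypK L minL sLP); apply: chain1; split; rewrite ?normal1 ?sub1G //.
  by right; rewrite indexg1.
have [/existsP[K /and3P[minK sKP neKL]] | noK] :=
  boolP [exists K : {group gT}, [&& minnormal K G, K \subset P & K != L]].
  apply: (hypercyclic_minnormal (hypK K minK sKP) minL sLP).
  apply/eqP; apply: contraR neKL => ntLK; apply/eqP/val_inj.
  have nsKG := minnormal_normal minK sKP sPG.
  apply/eqP; rewrite eqEsubset /= (minnormal_meet minL nsKG ntLK) andbT.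
  by apply: (minnormal_meet minK nsLG); rewrite setIC.
have uniqL (K : {group gT}) : minnormal K G -> K \subset P -> K :=: L.
  move=> minK sKP; apply/eqP; apply: contraR noK => neKL.
  by apply/existsP; exists K; rewrite minK sKP.
have [sLPh | nsLPh] := boolP (L \subset 'Phi(P)); last first.
  have sylPP : p.-Sylow(P) P by rewrite pHallE subxx /= part_pnat_id.
  exact: (minnormal_maximal_prime nsPG sylPP minL).
apply: (minnormal_prime minL (normal_sub nsLG) (pgroupS sLP pP)) => x Kx p'x.
apply: (subsetP (centS sLP)); have Gx := subsetP (residual_sub p G) x Kx.
apply: (coprime_cent_quotPhi pP _ p'x); first by rewrite (subsetP nPG).
apply: subset_trans sLPh; have nLG := normal_norm nsLG.
have nLP := subset_trans sPG nLG.
have nLx : <[x]> \subset 'N(L) by rewrite cycle_subG (subsetP nLG).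
rewrite -quotient_cents2 // centsC quotient_cycle ?cycle_subG //; last by rewrite -cycle_subG.
apply: (@hypercyclic_residual_cent _ (G / L)%G (P / L)%G _ p).
- exact: quotient_pgroup.
- apply: IHn.
  + rewrite -ltnS (leq_trans _ ltPn) // ltnS ltn_quotient //.
    by have /mingroupP[/andP[]] := minL.
  + exact: quotient_normal.
  + exact: quotient_pgroup.
  by apply: maximal_chains_quotient; rewrite //; left.
- by rewrite /= -residual_quotient // mem_quotient.
by apply: morph_p_elt; rewrite // -cycle_subG.
Qed.

(** Two distinct maximal [G]-normal subgroups of [P] generate [P], so let [T] be the only one. If
    [[~: P, 'C_G(T)]] is proper it lies in [T], and the [p']-elements of the residual, which
    centralise [T], act trivially on [P / T]. Otherwise [T] is central in [P] and contains
    ['Phi(P)], so every nontrivial element of [P] has order [p] or an order 4 covered by the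
    hypothesis. Take [x] outside [T], central modulo [T] in a Sylow subgroup of [G]: [<[x]> <*> T]
    is normal in [G], hence equals [P]. *)
Lemma normal_cyclic_hypercyclic (p : nat) (gT : finGroupType) (G P : {group gT}) :
  P <| G -> p.-group P -> cyclic_chains p G P -> hypercyclic G 1 P.
Proof.
have [n] := ubnP #|P|; elim: n => // n IHn in P * => ltPn nsPG pP chP.
have [sPG nPG] := andP nsPG.
have [P1 | ntP] := eqVneq (P : {set gT}) 1.
  by rewrite (_ : P = 1%G); [exact: chain0 | exact: val_inj].
have [prp _ _] := pgroup_pdiv pP ntP.
have IH (Y : {group gT}) : Y <| G -> Y \proper P -> hypercyclic G 1 Y.
  move=> nsY prY; have sYP := proper_sub prY; apply: IHn => //.
  - by rewrite -ltnS (leq_trans _ ltPn) // ltnS proper_card.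
  - exact: pgroupS pP.
  exact: cyclic_chainsS chP.
pose gP := [pred H : {group gT} | (H \proper P) && (G \subset 'N(H))].
have [|T maxT _] := @maxgroup_exists _ gP 1%G.
  by rewrite /= proper1G ntP norms1.
have /maxgroupP[/andP[prTP nTG] maxT'] := maxT; have sTP := proper_sub prTP.
have nsTG : T <| G by rewrite /normal nTG (subset_trans sTP).
have chT : chief_factor G T P by rewrite /chief_factor /maxnormal maxT.
have hT := IH T nsTG prTP.
have nTP := subset_trans sPG nTG.
have [/existsP[Y /and3P[nsYG prYP nsYT]] | noY] :=
  boolP [exists Y : {group gT}, [&& Y <| G, Y \proper P & ~~ (Y \subset T)]].
  have := hypercyclicY nsTG (IH Y nsYG prYP).
  have -> : (1 <*> T)%G = T by apply/val_inj; rewrite /= joing1G ?genGid.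
  have -> : (Y <*> T)%G = P; last exact: chain_trans hT.
  apply/val_inj/eqP; apply: contraR nsYT => neYT.
  have <- : (Y <*> T)%G = T; last exact: joing_subl.
  apply/val_inj/maxT'; last exact: joing_subr.
  rewrite /= properEneq neYT join_subG sTP (proper_sub prYP) /=.
  by rewrite normsY ?normal_norm.
have uniqT (Y : {group gT}) : Y <| G -> Y \subset P -> Y :!=: P -> Y \subset T.
  move=> nsY sYP neYP; apply: contraR noY => nsYT.
  by apply/existsP; exists Y; rewrite nsY properEneq neYP sYP.
suff prPT : prime #|P : T|.
  by apply: chainS hT _; split=> //; right.
have pPT : p.-group (P / T) := quotient_pgroup T pP.
have nsCG : 'C_G(T) <| G.
  by rewrite /normal subsetIl normsI ?normG // norms_cent.
have sRP : [~: P, 'C_G(T)] \subset P by rewrite commg_subl (subset_trans (subsetIl _ _)).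
have nsRG : [~: P, 'C_G(T)] <| G.
  by rewrite /normal (subset_trans sRP) // normsR // normal_norm.
have [eqR | neR] := eqVneq [~: P, 'C_G(T)] P; last first.
  have sRT := uniqT [~: P, 'C_G(T)]%G nsRG sRP neR.
  apply: (chief_factor_prime chT pPT) => x Kx p'x.
  apply: subset_trans sRT; rewrite commgS // cycle_subG inE.
  rewrite (subsetP (residual_sub p G)) //=.
  exact: hypercyclic_residual_cent (pgroupS sTP pP) hT Kx p'x.
have sTZ : T \subset 'Z(P).
  rewrite subsetI sTP /= centsC; apply/commG1P; rewrite -{1}eqR.
  have cTC : [~: 'C_G(T), T] = 1 by apply/commG1P; rewrite subsetIr.
  apply: three_subgroup; first by rewrite /= cTC comm1G.
  apply/commG1P; apply: subset_trans (_ : T \subset _); first by rewrite commg_subl.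
  by rewrite centsC subsetIr.
have abPT : p.-abelem (P / T).
  have [_ ntPT /is_abelemP[q prq abq]] := minnormal_solvable (chief_factor_minnormal chT) (subxx _) (pgroup_sol pPT).
  have [_ _ [k ok]] := pgroup_pdiv (abelem_pgroup abq) ntPT.
  suff -> : p = q by [].
  by have := pPT; rewrite /pgroup ok pnatX /= orbF pnatE // => /eqP.
have sPhT : 'Phi(P) \subset T := Phi_min pP nTP abPT.
have small := exponent_small pP (subset_trans (subsetIl G 'C(T)) nPG) eqR sTZ (subsetIr _ _) sPhT prp.
have [S sylS sPS] := Sylow_superset sPG pP; have [sSG pS _] := and3P sylS.
have nTS := subset_trans sSG nTG.
have ntPT : P / T != 1 by rewrite -subG1 quotient_sub1 // proper_subn.
have ntZ : P / T :&: 'Z(S / T) != 1.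
  apply: meet_center_nil => //; first exact: pgroup_nil (quotient_pgroup T pS).
  by rewrite /normal quotientS // quotient_norms // (subset_trans sSG).
have [_ /setIP[/morphimP[x Nx Px ->] Zx] ntx] := trivgPn _ ntZ.
have nTx : x \notin T by apply: contra ntx => Tx; rewrite /= coset_id.
have x1 : x != 1 by apply: contraNneq nTx => ->.
have chX : Pi_chain p G <[x]>.
  apply: chP; rewrite ?cycle_subG ?cycle_cyclic // -orderE; exact: small.
have [||A [B [stepAB nsPA sPB]]] :=
  chain_jump (P := [pred Y : {group gT} | P \subset Y]) chX.
- by rewrite /= subG1.
- by [].
have [nsA nsB _ _] := stepAB; rewrite /= in nsPA sPB.
have sPAT : P :&: A \subset T.
  apply: (uniqT (P :&: A)%G); rewrite ?normalI ?subsetIl //.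
  by apply: contra nsPA => /eqP <-; apply: subsetIr.
have sxP : <[x]> \subset P by rewrite cycle_subG.
have piN := Pi_step_join_top sxP nsPG stepAB sPB nsTG sTP sPAT.
have nxTS : S \subset 'N(<[x]> <*> T).
  apply/subsetP=> s Ss; rewrite inE -genJ gen_subG conjUg subUset.
  rewrite (normP (subsetP nTS s Ss)) joing_subr andbT -cycleJ cycle_subG.
  rewrite conjg_mulR; apply: groupM; first by rewrite (subsetP (joing_subl _ _)) ?cycle_id.
  apply: (subsetP (joing_subr _ _)).
  have sRT : [~: <[x]>, S] \subset T.
    rewrite -quotient_cents2 ?cycle_subG // quotient_cycle // cycle_subG.
    by case/setIP: Zx.
  by rewrite (subsetP sRT) // mem_commg ?cycle_id.
have nxTG := pnat_index_normal sylS nxTS piN.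
have sxTP : <[x]> <*> T \subset P by rewrite join_subG sxP.
have defP : <[x]> <*> T = P.
  apply/eqP; apply: contraR nTx => nexT; rewrite -cycle_subG.
  apply: subset_trans (joing_subl _ T) _; apply: (uniqT (<[x]> <*> T)%G) => //.
  by rewrite /normal (subset_trans sxTP).
rewrite -card_quotient // -defP quotientYidr ?cycle_subG // quotient_cycle //.
rewrite -orderE (abelem_order_p abPT) //; exact: mem_quotient.
Qed.

End NormalPgroupHypercyclic.

(** * Normal p-complements *)

Definition pnilpotent (gT : finGroupType) p (X : {group gT}) :=
  p.-nat #|X : 'O_p^'(X)|.

(** Only a lower bound: [p] may fail to divide [#|X|], so the property passes to subgroups and
    quotients. *)
Definition smallest_prime (gT : finGroupType) p (X : {group gT}) :=
  forall q, prime q -> q %| #|X| -> p <= q.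

Section PNilpotent.

Variable gT : finGroupType.
Implicit Types (p : nat) (A B C D E G H K L M N P Q R S T X Y : {group gT}).

Lemma smallest_prime_dvd (hT : finGroupType) p X (Y : {group hT}) :
  #|Y| %| #|X| -> smallest_prime p X -> smallest_prime p Y.
Proof. by move=> dv minp q prq dvq; apply: minp => //; apply: dvdn_trans dv. Qed.

Lemma smallest_prime_coprime p X n :
  prime p -> smallest_prime p X -> n %| #|X| -> coprime n p.-1.
Proof.
move=> prp minp dvn; rewrite /coprime; apply: contraT => ne1.
set g := gcdn n p.-1 in ne1.
have p1_gt0 : 0 < p.-1 by rewrite -subn1 subn_gt0 prime_gt1.
have g_gt0 : 0 < g by rewrite gcdn_gt0 p1_gt0 orbT.
have g_gt1 : 1 < g by rewrite ltn_neqAle eq_sym ne1.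
have prq := pdiv_prime g_gt1; set q := pdiv g in prq.
have : p <= q.
  by apply: minp => //; apply: dvdn_trans dvn; apply: dvdn_trans (pdiv_dvd g) (dvdn_gcdl _ _).
have : q <= p.-1.
  by apply: dvdn_leq => //; apply: dvdn_trans (pdiv_dvd g) (dvdn_gcdr _ _).
move=> le1 le2; have := leq_trans le2 le1.
by rewrite leqNgt prednK ?prime_gt0 // leqnn.
Qed.

Lemma pnilpotent_intro p X N :
  N <| X -> p^'.-group N -> p.-nat #|X : N| -> pnilpotent p X.
Proof.
by move=> nsN p'N; apply: pnat_dvd; apply: indexgS; apply: pcore_max.
Qed.

Lemma pnilpotent_pgroup p X : p.-group X -> pnilpotent p X.
Proof. by apply: pnat_dvd; apply: dvdn_indexg. Qed.

Lemma pnilpotent_normal p X Y :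
  Y <| X -> 'O_p^'(X) = 1 -> pnilpotent p Y -> p.-group Y.
Proof.
move=> nsY O1; rewrite /pnilpotent (_ : 'O_p^'(Y) = 1) ?indexg1 //.
apply/trivgP; rewrite -O1; apply: pcore_max; first exact: pcore_pgroup.
exact: char_normal_trans (pcore_char _ _) nsY.
Qed.

Lemma nilpotent_pnilpotent p X : nilpotent X -> pnilpotent p X.
Proof.
move=> nilX; rewrite /pnilpotent -divgS ?pcore_sub //.
rewrite -{1}(dprod_card (nilpotent_pcoreC p nilX)) mulnK ?cardG_gt0 //.
exact: pcore_pgroup.
Qed.

Lemma pnilpotent_quotient p X N :
  N <| X -> p^'.-group N -> pnilpotent p (X / N) -> pnilpotent p X.
Proof.
move=> nsN p'N; rewrite /pnilpotent.
have [T defT sNT nsTX] := inv_quotientN nsN (pcore_normal p^' (X / N)).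
have p'T : p^'.-group T.
  have nNT : T \subset 'N(N) := subset_trans (normal_sub nsTX) (normal_norm nsN).
  rewrite /pgroup -(Lagrange sNT) pnatM -card_quotient // -defT.
  by rewrite [p^'.-nat #|N|]p'N; apply: pcore_pgroup.
rewrite defT (@index_quotient_eq _ X N T) ?(subset_trans (subsetIr X N)) ?(normal_sub nsTX) ?(normal_norm nsN) //.
exact: pnilpotent_intro.
Qed.

Lemma hypercyclic_smallest_cent p G X T x :
    prime p -> smallest_prime p X -> X <| G -> hypercyclic G 1 T -> p.-group T ->
    x \in X -> p^'.-elt x ->
  x \in 'C(T).
Proof.
move=> prp minp nsX hT pT Xx p'x; apply: (hypercyclic_residual_cent pT hT _ p'x).
apply: coprime_pred_residual; first exact: subsetP (normal_sub nsX) x Xx.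
by apply: (smallest_prime_coprime prp minp); apply: order_dvdG.
Qed.

End PNilpotent.

Section CyclicSylow.

Variable gT : finGroupType.
Implicit Types (p : nat) (A B C D E G H K L M N P Q R S T X Y : {group gT}).

Lemma cyclic_Sylow_pnilpotent p X P :
    prime p -> p.-Sylow(X) P -> cyclic P -> smallest_prime p X ->
  pnilpotent p X.
Proof.
move=> prp sylP cycP minp; have [sPX pP p'iP] := and3P sylP.
have cent R a : R \subset X -> p.-group R -> a \in 'N_X(R) -> p^'.-elt a -> a \in 'C(R).
  move=> sRX pR /setIP[Xa nRa] p'a.
  have [x Xx sRPx] := Sylow_subJ sylP sRX pR.
  have cycR : cyclic R by apply: cyclicS sRPx _; rewrite cyclicJ.
  rewrite -ker_conj_aut; apply/kerP => //.
  apply/eqP; rewrite -order_eq1 -dvdn1.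
  have co : coprime #[a] #|Aut R|.
    rewrite card_Aut_cyclic // (card_pgroup pR).
    case: (logn p #|R|) => [|k]; first by rewrite expn0 coprimen1.
    rewrite totient_pfactor // coprimeMr (smallest_prime_coprime prp minp) ?order_dvdG //=.
    by rewrite coprimeXr // coprime_sym prime_coprime // -p'natE.
  rewrite -(eqnP co) dvdn_gcd morph_order //= order_dvdG //.
  by apply: (subsetP (Aut_conj_aut R 'N(R))); rewrite mem_morphim.
have := focal_of_cent sylP cent; rewrite (derG1P (cyclic_abelian cycP)) => sP1.
have p'X' : p^'.-group X^`(1).
  have sylX' := Hall_setI_normal (der_normal 1 X) sylP.
  move: sylX'; rewrite (trivgP sP1) => /and3P[_ _].
  by rewrite indexg1.
apply: (pnilpotent_quotient (der_normal 1 X) p'X').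
by apply: nilpotent_pnilpotent; rewrite abelian_nil // der_abelian.
Qed.

End CyclicSylow.

Section SylowNilpotent.

(** Reduce to ['O_p^'(X) = 1]. If a minimal normal subgroup [L] of [G] in [X] is a [p]-group,
    induction gives a normal [T] with [T / L] a [p']-group and [X / T] a [p]-group. For unique [L]
    the point is that [L] normalises a complement [Q] of [L] in [T]: a Frattini argument if
    [L \subset 'Phi(P)], and otherwise [L] has order [p] and [T] centralises it. If no such [L]
    exists, a maximal subgroup of [P] misses some minimal normal [K], which is [p]-nilpotent by the
    cyclic case. *)
Lemma maximal_pnilpotent (p : nat) (gT : finGroupType) (G X P : {group gT}) :
    prime p -> X <| G -> p.-Sylow(X) P -> smallest_prime p X ->
    maximal_chains p G P ->
  pnilpotent p X.
Proof.
move=> prp; have [n] := ubnP #|X|; elim: n => // n IHn in gT G X P * => ltXn nsXG sylP minp chP.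
have [sXG nXG] := andP nsXG; have [sPX pP p'iP] := and3P sylP.
have sPG := subset_trans sPX sXG.
have [cycP | ncycP] := boolP (cyclic P).
  exact: cyclic_Sylow_pnilpotent sylP cycP minp.
have ntP : P :!=: 1 by apply: contraNneq ncycP => ->; apply: cyclic1.
have IHq (N : {group gT}) : N <| G -> N :!=: 1 -> N \subset X ->
    N \subset P \/ p^'.-group N -> pnilpotent p (X / N).
  move=> nsNG ntN sNX hN; have nNX := subset_trans sXG (normal_norm nsNG).
  apply: (IHn _ (G / N)%G _ (P / N)%G).
  - by rewrite -ltnS (leq_trans _ ltXn) // ltnS ltn_quotient.
  - exact: quotient_normal.
  - by apply: quotient_pHall => //; apply: subset_trans nNX.
  - by apply: smallest_prime_dvd minp; apply: dvdn_quotient.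
  exact: maximal_chains_quotient.
have [O1 | ntO] := eqVneq 'O_p^'(X) 1; last first.
  apply: (@pnilpotent_quotient _ p X 'O_p^'(X)); rewrite ?pcore_normal ?pcore_pgroup //.
  by apply: IHq; rewrite ?pcore_sub ?gFnormal_trans //; right; apply: pcore_pgroup.
have ntX : X :!=: 1 by apply: subG1_contra ntP.
have normX (K : {group gT}) : minnormal K G -> K \subset X -> K <| G.
  by move=> minK sKX; apply: minnormal_normal minK sKX sXG.
have p'1 (K : {group gT}) : minnormal K G -> K \subset X -> ~~ p^'.-group K.
  move=> minK sKX; apply/negP=> p'K; have /mingroupP[/andP[/negP[]]] := minK.
  rewrite -subG1 -O1 pcore_max // (normalS sKX sXG) //; exact: normX.
have pKP (K : {group gT}) : minnormal K G -> K \subset X -> p.-group K -> K \subset P.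
  move=> minK sKX pK; apply: subset_trans (pcore_sub_Hall sylP).
  by rewrite pcore_max // (normalS sKX sXG) //; apply: normX.
have big (K : {group gT}) : minnormal K G -> K \subset X -> p.-group K ->
    exists T : {group gT}, [/\ T <| G, K \subset T, T \subset X, p^'.-group (T / K) & p.-nat #|X : T|].
  move=> minK sKX pK; have nsKG := normX K minK sKX.
  have nsKX : K <| X := normalS sKX sXG nsKG.
  have nsOG : 'O_p^'(X / K) <| G / K by apply: gFnormal_trans; apply: quotient_normal.
  have [T defT sKT nsTG] := inv_quotientN nsKG nsOG.
  have sTX : T \subset X.
    by rewrite -(quotientSGK (subset_trans (normal_sub nsTG) (normal_norm nsKG)) sKX) -defT pcore_sub.
  exists T; split=> //; first by rewrite -defT pcore_pgroup.
  rewrite -(@index_quotient_eq _ X K T) ?normal_norm ?(subset_trans (subsetIr X K)) // -defT.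
  apply: IHq => //; last by left; apply: pKP.
  by have /mingroupP[/andP[]] := minK.
have [/existsP[L /and3P[minL sLX pL]] | noL] :=
  boolP [exists L : {group gT}, [&& minnormal L G, L \subset X & p.-group L]].
  have [T [nsTG sLT sTX p'TL piT]] := big L minL sLX pL.
  have nsLG := normX L minL sLX.
  have nsTX : T <| X := normalS sTX sXG nsTG.
  have nsLX : L <| X := normalS sLX sXG nsLG.
  have nLT : T \subset 'N(L) := subset_trans sTX (normal_norm nsLX).
  have [/existsP[K /and3P[minK sKX neKL]] | noK] :=
    boolP [exists K : {group gT}, [&& minnormal K G, K \subset X & K != L]].
    have nsKG := normX K minK sKX.
    have tiKL : K :&: L = 1.
      apply/eqP; apply: contraR neKL => ntKL; apply/eqP/val_inj/eqP.
      rewrite eqEsubset /= (minnormal_meet minK nsLG ntKL).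
      by apply: (minnormal_meet minL nsKG); rewrite setIC.
    have tiKT : K :&: T = 1.
      apply/eqP; apply: contraR (p'1 K minK sKX) => ntKT.
      have sKT := minnormal_meet minK nsTG ntKT.
      rewrite /pgroup -indexg1 -tiKL indexgI -indexMg.
      have nLK := subset_trans sKT nLT.
      rewrite -norm_joinEr // -card_quotient; last by rewrite join_subG normG.
      by apply: pgroupS p'TL; rewrite quotientS // join_subG sLT.
    have pK : p.-group K.
      rewrite /pgroup -indexg1 -tiKT indexgI -indexMg.
      have nTK : K \subset 'N(T) := subset_trans sKX (normal_norm nsTX).
      rewrite -norm_joinEr //; apply: pnat_dvd piT.
      by apply: indexSg; rewrite ?joing_subl // join_subG sTX.
    have [T2 [nsT2G sKT2 sT2X p'T2K piT2]] := big K minK sKX pK.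
    have nsT2X : T2 <| X := normalS sT2X sXG nsT2G.
    (* [T :&: T2] meets [K] trivially, so it embeds in the [p']-group [T2 / K], while both [T] and
       [T2] have [p]-power index. *)
    apply: (@pnilpotent_intro _ p X (T :&: T2)%G); first exact: normalI.
      rewrite /pgroup -indexg1 -[1%g in X in #|_ : X|](_ : T :&: T2 :&: K = 1); last first.
        by apply/trivgP; rewrite -tiKT [K :&: T]setIC setSI ?subsetIl.
      have nKT2 : T2 \subset 'N(K).
        by rewrite (subset_trans sT2X) // (subset_trans sXG) ?normal_norm.
      have nKTT2 : T :&: T2 \subset 'N(K) := subset_trans (subsetIr _ _) nKT2.
      rewrite indexgI -indexMg -norm_joinEr //.
      have := p'T2K; rewrite /pgroup card_quotient //; apply: pnat_dvd.
      by rewrite indexSg ?joing_subl // join_subG sKT2 subsetIr.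
    rewrite -(Lagrange_index sTX (subsetIl T T2)) pnatM piT /=.
    rewrite indexgI -indexMg -norm_joinEr ?(subset_trans sTX) ?normal_norm //.
    by apply: pnat_dvd piT2; apply: indexSg; rewrite ?joing_subl // join_subG sT2X.
  have uniqL (K : {group gT}) : minnormal K G -> K \subset X -> K :=: L.
    move=> minK sKX; apply/eqP; apply: contraR noK => neKL.
    by apply/existsP; exists K; rewrite minK sKX.
  have sLP := pKP L minL sLX pL.
  have hallL : Hall T L.
    rewrite /Hall sLT (@pnat_coprime p) // -card_quotient //.
  have [Q /complP[tiLQ defT]] := splitsP (SchurZassenhaus_split hallL (normalS sLT sTX nsLX)).
  have sQT : Q \subset T by rewrite -defT mulG_subr.
  have nLQ := subset_trans sQT nLT.
  have p'Q : p^'.-group Q.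
    by rewrite /pgroup -indexg1 -tiLQ setIC indexgI -indexMg defT -card_quotient.
  have coLQ : coprime #|L| #|Q| := pnat_coprime pL p'Q.
  (* Frattini argument: the complements of [L] in [T] are conjugate under [L]. *)
  have defX : L * 'N_X(Q) = X.
    apply/eqP; rewrite eqEsubset mul_subG ?subsetIl //=.
    apply/subsetP=> x Xx.
    have [|l Ll eqQ] := SchurZassenhaus_trans_sol (pgroup_sol pL) nLQ _ coLQ (cardJg Q x).
      by rewrite defT -(normP (subsetP (normal_norm nsTX) x Xx)) conjSg.
    have nlx : x * l^-1 \in 'N_X(Q).
      rewrite /= in eqQ; apply/setIP; split; first by rewrite groupM // groupV (subsetP sLX).
      by rewrite inE conjsgM eqQ conjsgK.
    have: x * l^-1 * l \in 'N_X(Q) * L by rewrite mem_mulg.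
    have nLN : 'N_X(Q) \subset 'N(L) := subset_trans (subsetIl _ _) (normal_norm nsLX).
    by rewrite mulgKV (normC nLN).
  suff nQL : L \subset 'N(Q).
    have nsQX : Q <| X.
      by rewrite /normal (subset_trans sQT) //= -{1}defX mul_subG // subsetIr.
    have Q1 : Q :=: 1 by apply/trivgP; rewrite -O1 pcore_max.
    apply: pnilpotent_pgroup; rewrite /pgroup -(Lagrange sTX) pnatM piT andbT.
    by rewrite -defT Q1 mulg1.
  have [sLPh | nsLPh] := boolP (L \subset 'Phi(P)).
    have defP : 'Phi(P) <*> 'N_P(Q) = P.
      apply/eqP; rewrite eqEsubset join_subG Phi_sub subsetIl /=.
      have ePL : P :=: L * 'N_P(Q).
        rewrite -[X in X = _](setIidPl sPX) -{1}defX setIC.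
        rewrite -group_modl // setIAC [_ :&: P]setIC (setIidPl sPX) //.
      have sPL : P \subset L * 'N_P(Q) by rewrite -ePL.
      by rewrite (subset_trans sPL) // mul_subG ?joing_subr // (subset_trans sLPh) ?joing_subl.
    have := Phi_nongen defP; rewrite genGid => /setIidPl nQP.
    exact: subset_trans sLP nQP.
  have prL : prime #|L| := minnormal_maximal_prime nsXG sylP minL sLP uniqL nsLPh chP.
  have oL : #|L| = p by apply/eqP; move: pL; rewrite /pgroup pnatE.
  apply: cents_norm; rewrite centsC; apply: subset_trans sQT _.
  apply/subsetP=> x Tx; have Xx := subsetP sTX x Tx.
  apply: (subsetP (residual_cent_prime nsLX oL prp)).
  apply: coprime_pred_residual => //.
  by apply: (smallest_prime_coprime prp minp); apply: order_dvdG.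
have [P1 | [M maxM _]] := maximal_exists (sub1G P).
  by case/eqP: ntP; rewrite -P1.
have [||A [B [stepAB tiXA ntXB]]] :=
  chain_jump (P := [pred Y : {group gT} | X :&: Y != 1]) (chP M maxM).
- by rewrite /= (setIidPr (sub1G X)) eqxx.
- by rewrite /= (setIidPl sXG).
have {}tiXA : X :&: A = 1 by apply/eqP; move: tiXA; rewrite /= negbK.
have [nsA nsB _ _] := stepAB.
have [K minK sKXB] := minnormal_exists ntXB (normal_norm (normalI nsXG nsB)).
have sKX : K \subset X := subset_trans sKXB (subsetIl _ _).
have nsKG := normX K minK sKX; have nsKX : K <| X := normalS sKX sXG nsKG.
have sMP := proper_sub (maxgroupp maxM); have sMX := subset_trans sMP sPX.
have piMK := Pi_step_meet_bottom sMX nsXG stepAB tiXA nsKG sKXB.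
have npK : ~~ p.-group K.
  by apply: contra noL => pK; apply/existsP; exists K; rewrite minK sKX.
(* Otherwise [M :&: K] is a nontrivial subgroup of ['O_p(G)], which by minimality contains [K]. *)
have tiMK : M :&: K = 1.
  apply/eqP; apply: contraR npK => ntMK.
  have sMKO : M :&: K \subset 'O_p(G).
    apply: pnat_index_pcore piMK; first by rewrite (pgroupS (subsetIl _ _)) // (pgroupS sMP).
    by rewrite subIset // (subset_trans sMX).
  apply: (@pgroupS _ _ 'O_p(G)); last exact: pcore_pgroup.
  apply: (minnormal_meet minK (pcore_normal p G)).
  by apply: subG1_contra ntMK; rewrite subsetI subsetIr.
have sylPK : p.-Sylow(K) (P :&: K) := Hall_setI_normal nsKX sylP.
have cycPK : cyclic (P :&: K).
  have dvp : #|P :&: K| %| p.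
    rewrite -(p_maximal_index pP maxM) -indexg1.
    have tiPKM : P :&: K :&: M = 1.
      by apply/trivgP; rewrite /= -tiMK [_ :&: M]setIC setIS ?subsetIr.
    rewrite -tiPKM.
    rewrite indexgI -indexMg.
    have nMPK : P :&: K \subset 'N(M).
      by rewrite subIset // normal_norm ?(p_maximal_normal pP).
    by rewrite -norm_joinEr // indexSg ?joing_subl // join_subG sMP subsetIl.
  have /primeP[_ /(_ _ dvp)/orP[|/eqP oPK]] := prp; last by rewrite prime_cyclic ?oPK.
  by rewrite -trivg_card1 => /eqP->; apply: cyclic1.
case/negP: npK; apply: (pnilpotent_normal nsKX O1).
by apply: cyclic_Sylow_pnilpotent prp sylPK cycPK (smallest_prime_dvd (cardSg sKX) minp).
Qed.

(** After reducing to ['O_p^'(X) = 1] with [X] not a [p]-group, every proper [G]-normal subgroup of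
    [X] lies in [T = 'O_p(X)]. [T] is hypercyclically embedded, so [p']-elements centralise it and
    [T] is central in [X]. If [X^](1)[is proper,]X[is nilpotent. If]X[is perfect, the elements of
    small order fall into]T[, so]p'[-elements centralise the]p[-subgroups they normalise; the focal
    subgroup theorem gives]P \subset P^[(1)], whence [P = 1]. *)
Lemma cyclic_pnilpotent (p : nat) (gT : finGroupType) (G X P : {group gT}) :
    prime p -> X <| G -> p.-Sylow(X) P -> smallest_prime p X ->
    cyclic_chains p G P ->
  pnilpotent p X.
Proof.
move=> prp; have [n] := ubnP #|X|; elim: n => // n IHn in gT G X P * => ltXn nsXG sylP minp chP.
have [sXG nXG] := andP nsXG; have [sPX pP p'iP] := and3P sylP.
have sPG := subset_trans sPX sXG.
have [O1 | ntO] := eqVneq 'O_p^'(X) 1; last first.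
  have nsOG : 'O_p^'(X) <| G := gFnormal_trans _ nsXG.
  have nOX := normal_norm (pcore_normal p^' X).
  apply: (@pnilpotent_quotient _ p X 'O_p^'(X)); rewrite ?pcore_normal ?pcore_pgroup //.
  apply: (IHn _ (G / 'O_p^'(X))%G _ (P / 'O_p^'(X))%G).
  - by rewrite -ltnS (leq_trans _ ltXn) // ltnS ltn_quotient ?pcore_sub.
  - exact: quotient_normal.
  - by apply: quotient_pHall => //; apply: subset_trans nOX.
  - by apply: smallest_prime_dvd minp; apply: dvdn_quotient.
  by apply: cyclic_chains_quotient; rewrite ?pcore_pgroup.
have [pX | npX] := boolP (p.-group X); first exact: pnilpotent_pgroup.
have properP (Y : {group gT}) : Y <| G -> Y \proper X -> p.-group Y.
  move=> nsYG prY; have sYX := proper_sub prY; have nsYX := normalS sYX sXG nsYG.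
  apply: (pnilpotent_normal nsYX O1); apply: (IHn _ G _ (P :&: Y)%G) => //.
  - by rewrite -ltnS (leq_trans _ ltXn) // ltnS proper_card.
  - exact: Hall_setI_normal nsYX sylP.
  - exact: smallest_prime_dvd (cardSg sYX) minp.
  exact: cyclic_chainsS (subsetIl _ _) chP.
pose T := 'O_p(X)%G; have nsTG : T <| G := gFnormal_trans _ nsXG.
have pT : p.-group T := pcore_pgroup p X.
have sTX : T \subset X := pcore_sub p X.
have properT (Y : {group gT}) : Y <| G -> Y \proper X -> Y \subset T.
  move=> nsYG prY; have sYX := proper_sub prY.
  by rewrite pcore_max ?(properP Y) // (normalS sYX sXG).
have sTP : T \subset P := pcore_sub_Hall sylP.
have hT : hypercyclic G 1 T.
  exact: normal_cyclic_hypercyclic nsTG pT (cyclic_chainsS sTP chP).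
have p'cT x : x \in X -> p^'.-elt x -> x \in 'C(T).
  exact: hypercyclic_smallest_cent prp minp nsXG hT pT.
have nsCG : 'C_X(T) <| G.
  by rewrite /normal subIset ?sXG //= normsI ?norms_cent // normal_norm.
have cTX : X \subset 'C(T).
  apply/setIidPl/eqP; apply: contraR npX => neC.
  have pC : p.-group 'C_X(T) by apply: (properP 'C_X(T)%G); rewrite // properEneq neC subsetIl.
  have nCX : X \subset 'N('C_X(T)) := subset_trans sXG (normal_norm nsCG).
  rewrite /pgroup -(Lagrange (subsetIl X 'C(T))) pnatM [p.-nat _]pC -card_quotient //=.
  by apply: pquotient_of_elts => // x Xx p'x; rewrite inE Xx p'cT.
have [eqX' | neX'] := eqVneq X^`(1) X; last first.
  apply: nilpotent_pnilpotent; rewrite -quotient_center_nil abelian_nil //.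
  apply: sub_der1_abelian; apply: subset_trans (_ : T \subset _).
    by apply: (properT X^`(1)%G); rewrite ?gFnormal_trans // properEneq neX' der_sub.
  by rewrite subsetI sTX centsC.
have small x : x \in P -> #[x] = p \/ (#[x] = 4 /\ ~ quaternion_free P) -> x \in T.
  move=> Px ox; have sxP : <[x]> \subset P by rewrite cycle_subG.
  have chx : Pi_chain p G <[x]> by apply: chP; rewrite ?cycle_cyclic // -orderE.
  have [||A [B [stepAB nsXA sXB]]] :=
    chain_jump (P := [pred Y : {group gT} | X \subset Y]) chx.
  - by rewrite /= subG1; apply: contra npX => /eqP->; apply: pgroup1.
  - by [].
  have [nsA nsB _ _] := stepAB; rewrite /= in nsXA sXB.
  have sXAT : X :&: A \subset T.
    apply: (properT (X :&: A)%G); first exact: normalI.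
    by rewrite properE subsetIl subsetI subxx.
  have sxX := subset_trans sxP sPX.
  have piN := Pi_step_join_top sxX nsXG stepAB sXB nsTG sTX sXAT.
  have sxTX : <[x]> <*> T \subset X by rewrite join_subG sxX.
  have sxO : <[x]> <*> T \subset 'O_p(G).
    apply: pnat_index_pcore piN; last exact: subset_trans sXG.
    by apply: (pgroupS _ pP); rewrite join_subG sxP.
  have sOT : 'O_p(G) :&: X \subset T.
    rewrite pcore_max ?(pgroupS (subsetIl _ _)) ?pcore_pgroup //.
    by apply: (normalS (subsetIr _ _) sXG); rewrite normalI ?pcore_normal.
  by rewrite (subsetP sOT) // inE (subsetP sxO) ?(subsetP sxX) ?(subsetP (joing_subl _ _)) ?cycle_id.
have cent (R : {group gT}) a : R \subset X -> p.-group R -> a \in 'N_X(R) -> p^'.-elt a -> a \in 'C(R).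
  move=> sRX pR /setIP[Xa nRa] p'a.
  have [g Xg sRPg] := Sylow_subJ sylP sRX pR.
  apply: (pelt_cent_of_small prp pR p'a nRa) => x Rx ox.
  have Pxg : x ^ g^-1 \in P by rewrite -mem_conjg (subsetP sRPg).
  have Tx : x ^ g^-1 \in T.
    apply: small => //; rewrite orderJ; case: ox => [|[o4 nqR]]; [by left | right; split=> // qP].
    apply: nqR; apply: (@quaternion_free_isog _ _ (R :^ g^-1)%G).
      by rewrite isog_sym; apply: conj_isog.
    by apply: (quaternion_free_sub _ qP); rewrite /= sub_conjgV.
  have {}Tx : x \in T.
    by rewrite -(memJ_norm x (_ : g^-1 \in 'N(T))) // groupV (subsetP (normal_norm nsTG)) // (subsetP sXG).
  by rewrite cent1C; apply/cent1P/(centP (subsetP cTX a Xa)).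
have := focal_of_cent sylP cent; rewrite eqX' (setIidPl sPX) => sPP'.
have P1 : P :=: 1.
  apply/eqP; apply: contraT => ntP.
  by have := sol_der1_proper (pgroup_sol pP) (subxx P) ntP; rewrite properE sPP' andbF.
case/negP: npX; have p'X : p^'.-group X.
  by rewrite /pgroup -indexg1 -P1.
suff -> : X :=: 1 by apply: pgroup1.
by apply/trivgP; rewrite -O1 pcore_max.
Qed.

End SylowNilpotent.

(** * From [p]-nilpotence to hypercyclic embedding of [X] *)

Section SylowTower.

Lemma cyclic_pgroup_hypercyclic (p : nat) (gT : finGroupType) (G P : {group gT}) :
  P <| G -> p.-group P -> cyclic P -> hypercyclic G 1 P.
Proof.
move=> nsPG pP cycP; apply: hypercyclic_of_chief => // [||C D chCD _ sDP].
- exact: normal1.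
- exact: sub1G.
have minD := chief_factor_minnormal chCD.
have /andP[/maxgroupp/andP[prCD nCG] /normal_sub sDG] := chCD.
have nCD := subset_trans sDG nCG.
have [_ ntDC /is_abelemP[q prq abq]] :=
  minnormal_solvable minD (subxx _) (pgroup_sol (quotient_pgroup C (pgroupS sDP pP))).
rewrite -card_quotient // (cyclic_abelem_prime abq) //.
exact: quotient_cyclic (cyclicS sDP cycP).
Qed.

Lemma sylow_chains_hypercyclic (gT : finGroupType) (G X : {group gT}) :
    X <| G ->
    (forall (p : nat) (P : {group gT}), prime p -> p.-Sylow(X) P -> ~~ cyclic P ->
       maximal_chains p G P \/ cyclic_chains p G P) ->
  hypercyclic G 1 X.
Proof.
have [n] := ubnP #|X|; elim: n => // n IHn in X * => ltXn nsXG chX.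
have [sXG nXG] := andP nsXG.
have [X1 | ntX] := eqVneq (X : {set gT}) 1.
  by rewrite (_ : X = 1%G); [exact: chain0 | exact: val_inj].
pose p := pdiv #|X|.
have prp : prime p by rewrite pdiv_prime // cardG_gt1.
have minp : smallest_prime p X.
  by move=> q prq dvq; apply: pdiv_min_dvd; rewrite ?prime_gt1.
have [P sylP] := Sylow_exists p X; have [sPX pP p'iP] := and3P sylP.
have sPG := subset_trans sPX sXG.
have pnilX : pnilpotent p X.
  have [cycP | ncycP] := boolP (cyclic P).
    exact: cyclic_Sylow_pnilpotent prp sylP cycP minp.
  have [maxP | cycP] := chX p P prp sylP ncycP.
    exact: maximal_pnilpotent prp nsXG sylP minp maxP.
  exact: cyclic_pnilpotent prp nsXG sylP minp cycP.
pose N := 'O_p^'(X)%G; have nsNG : N <| G := gFnormal_trans _ nsXG.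
have p'N : p^'.-group N := pcore_pgroup _ _.
have sNX : N \subset X := pcore_sub _ _.
have prNX : N \proper X.
  rewrite properEneq sNX andbT; apply: contraL p'N => /eqP->.
  by apply/negP=> p'X; have := pgroupP p'X p prp (pdiv_dvd _); rewrite !inE eqxx.
have hN : hypercyclic G 1 N.
  apply: IHn => // [|q Q prq sylQ ncycQ].
    by rewrite -ltnS (leq_trans _ ltXn) // ltnS proper_card.
  (* [#|X : N|] is a power of [p] and a noncyclic [Q] is nontrivial, so [q] differs from [p] and [Q]
     is also a Sylow subgroup of [X]. *)
  apply: chX => //; have [sQN qQ q'iQ] := and3P sylQ.
  apply/and3P; split=> //; first exact: subset_trans sNX.
  rewrite -(Lagrange_index sNX sQN) pnatM [q^'.-nat #|N : Q|]q'iQ andbT.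
  apply: sub_in_pnat pnilX => r _; rewrite !inE => /eqP->; apply/eqP=> eqpq.
  case/negP: ncycQ; rewrite -eqpq in qQ.
  by rewrite (_ : Q :=: 1) ?cyclic1 //; apply/eqP; rewrite trivg_card1; apply/eqP/(pnat_1 qQ)/(pgroupS sQN p'N).
apply: chain_trans hN _; apply: hypercyclic_quotient => //.
have nNX := subset_trans sXG (normal_norm nsNG).
have nNP := subset_trans sPX nNX.
have eqXP : (X / N = P / N)%g.
  apply/eqP; rewrite eq_sym eqEcard quotientS //=.
  have sylPN : p.-Sylow(X / N) (P / N) by apply: quotient_pHall.
  by rewrite (card_Hall sylPN) part_pnat_id // card_quotient.
have {eqXP} eqXP : (X / N)%G = (P / N)%G by apply: val_inj.
have nsPN : P / N <| G / N by rewrite -[X in X <| _]/(gval (P / N)%G) -eqXP quotient_normal.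
have pPN : p.-group (P / N) := quotient_pgroup N pP.
rewrite eqXP; have [cycP | ncycP] := boolP (cyclic P).
  exact: cyclic_pgroup_hypercyclic nsPN pPN (quotient_cyclic N cycP).
have [maxP | cycP] := chX p P prp sylP ncycP.
  by apply: (normal_maximal_hypercyclic nsPN pPN); apply: maximal_chains_quotient => //; right.
by apply: (normal_cyclic_hypercyclic nsPN pPN); apply: cyclic_chains_quotient.
Qed.

End SylowTower.

(** * Quasinilpotent normal subgroups *)

Section Quasinilpotent.

Variable gT : finGroupType.
Implicit Types (p : nat) (A B C D E G H K L M N P Q R S T X Y Z : {group gT}).

(** [M] is a direct product of simple groups; each factor either lies in [B] or meets [B] trivially,
    and then it commutes with [B]. *)
Lemma charsimple_normal_cent M B :
  charsimple M -> B <| M -> M \subset B <*> 'C_M(B).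
Proof.
case/charsimple_dprod=> H [sHM simH [I Iaut defM]] nsBM.
have [sBM nBM] := andP nsBM.
rewrite -{1}(bigdprodWY defM) gen_subG; apply/bigcupsP=> f If.
have Af := subsetP Iaut f If; pose Hf := (autm Af @* H)%G.
have defHf : Hf = f @: H :> {set gT} by rewrite /= morphimEsub.
have simHf : simple Hf by rewrite -(isog_simple (sub_isog sHM (injm_autm Af))).
have nsHf : Hf <| M.
  by move: defM; rewrite (bigD1 f If) /= -defHf => /dprod_normal2[].
have [sHfM nHfM] := andP nsHf; rewrite -defHf.
have /simpleP[_ /(_ (Hf :&: B)%G (normalGI sHfM nsBM))[tiHB | sHB]] := simHf.
  apply: subset_trans (joing_subr _ _); rewrite subsetI sHfM /=.
  apply/commG1P/trivgP; rewrite -tiHB commg_subI // subsetI subxx.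
    exact: subset_trans sHfM nBM.
  exact: subset_trans sBM nHfM.
by apply: subset_trans (joing_subl _ _); rewrite -sHB subsetIr.
Qed.

End Quasinilpotent.

Section QuasinilpotentNormal.

Variable gT : finGroupType.
Implicit Types (p : nat) (A B C D E G H K L M N P Q R S T X Y Z : {group gT}).

Lemma inner_of_mul L K A C :
    L \subset K * C -> K \subset 'N(A) -> C \subset 'N(A) -> [~: K, C] \subset A ->
  [forall x in L / A, exists k in K / A, forall y in K / A, y ^ x == y ^ k].
Proof.
move=> sLKC nAK nAC sRA; apply/forall_inP=> xb Lx.
have: xb \in (K / A) * (C / A) by rewrite -quotientMl // (subsetP (quotientS A sLKC)).
case/mulsgP=> k c Kk Cc ->; apply/exists_inP; exists k => //.
apply/forall_inP=> y Ky; rewrite conjgM (conjgE _ c).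
have cKC : K / A \subset 'C(C / A) by rewrite quotient_cents2.
have Kyk : y ^ k \in K / A by rewrite groupJ.
by rewrite (centP (subsetP cKC _ Kyk) c Cc) mulKg.
Qed.

Lemma nilpotent_quasinilpotent L : nilpotent L -> quasinilpotent L.
Proof.
move=> nilL; apply/forallP=> A; apply/forallP=> K; apply/implyP=> chK.
have minK := chief_factor_minnormal chK.
have /andP[/maxgroupp/andP[prAK nAL] nsKL] := chK.
have sKL := normal_sub nsKL; have nAK := subset_trans sKL nAL.
apply: (inner_of_mul (C := L)) => //; first exact: mulG_subr.
rewrite -quotient_cents2 //.
have ntK : K / A != 1 by rewrite -subG1 quotient_sub1 // proper_subn.
have ntKZ : K / A :&: 'Z(L / A) != 1.
  by apply: meet_center_nil => //; [apply: quotient_nil | apply: quotient_normal].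
apply: subset_trans (_ : 'Z(L / A) \subset _); last by rewrite subsetIr.
by apply: (minnormal_meet minK) => //; apply: center_normal.
Qed.

(** For a chief factor [K / A]: if [K :&: Z] is not inside [A], then [K = (K :&: Z) A] and the
    factor is central. Otherwise [L / Z] is the product of the image of [K] and its centraliser
    [C / Z], and [[~: K, C] \subset K :&: Z \subset A]. *)
Lemma central_charsimple_quasinilpotent L Z :
  Z \subset 'Z(L) -> charsimple (L / Z) -> quasinilpotent L.
Proof.
move=> sZZ simL; apply/forallP=> A; apply/forallP=> K; apply/implyP=> chK.
have /andP[maxA nsKL] := chK; have /maxgroupP[/andP[prAK nAL] maxA'] := maxA.
have sKL := normal_sub nsKL; have nAK := subset_trans sKL nAL.
have sZL : Z \subset L := subset_trans sZZ (center_sub L).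
have cZL : L \subset 'C(Z) by rewrite centsC (subset_trans sZZ) ?subsetIr.
have nZL : L \subset 'N(Z) := cents_norm cZL.
have nAKZ : K :&: Z \subset 'N(A) := subset_trans (subsetIl _ _) nAK.
have [sKZA | nsKZA] := boolP (K :&: Z \subset A); last first.
  apply: (inner_of_mul (C := L)) => //; first exact: mulG_subr.
  have defK : (K :&: Z) <*> A = K.
    apply/eqP; apply: contraR nsKZA => neK.
    have <- : ((K :&: Z) <*> A)%G = A :> {set gT}; last exact: joing_subl.
    apply: maxA'; last exact: joing_subr.
    rewrite /= properEneq neK join_subG subsetIl (proper_sub prAK) /=.
    by rewrite normsY // normsI ?(normal_norm nsKL) // cents_norm.
  rewrite -quotient_cents2 // -defK quotientYidr //.
  by rewrite quotient_cents // (subset_trans (subsetIr K Z)) // centsC.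
have nsKZ : K / Z <| L / Z := quotient_normal Z nsKL.
have nsZL : Z <| L by rewrite /normal sZL.
have [C defC sZC sCL] := inv_quotientS nsZL (subsetIl (L / Z) 'C(K / Z)).
have nAC := subset_trans sCL nAL; have nZC := subset_trans sCL nZL.
have nZK := subset_trans sKL nZL.
apply: (inner_of_mul (C := C)) => //.
  have nCK : C \subset 'N(K) := subset_trans sCL (normal_norm nsKL).
  rewrite -norm_joinEr //.
  have sZKC : Z \subset K <*> C := subset_trans sZC (joing_subr _ _).
  rewrite -(quotientSGK _ sZKC) // quotientY // -defC.
  exact: charsimple_normal_cent.
apply: subset_trans sKZA; rewrite subsetI.
rewrite commg_subl (subset_trans sCL) ?normal_norm //= -quotient_cents2 //.
by rewrite -defC centsC subsetIr.
Qed.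

Lemma quasinilpotent_sub_gFitting E H :
  H <| E -> quasinilpotent H -> H \subset generalized_Fitting E.
Proof. by move=> nsH qH; rewrite sub_gen // (bigcup_max H) ?nsH. Qed.

(** If not, take [L / Z] minimal normal in [E / Z] below [C / Z], where [C] is the centraliser and
    [Z = C :&: F]. [L] centralises [Z] and [L / Z] is characteristically simple, so [L] is
    quasinilpotent and lies in [F], hence in [Z]. *)
Lemma cent_gFitting E :
  'C_E(generalized_Fitting E) \subset generalized_Fitting E.
Proof.
pose F := (<<\bigcup_(H : {group gT} | (H <| E) && quasinilpotent H) H>>)%G.
have defF : generalized_Fitting E = F by [].
rewrite defF; have sFE : F \subset E.
  by rewrite gen_subG; apply/bigcupsP=> H /andP[/normal_sub].
have nFE : E \subset 'N(F).
  rewrite norms_gen // norms_bigcup //; apply/bigcapsP=> H /andP[nsH _].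
  exact: normal_norm.
pose C := 'C_E(F)%G; pose Z := (C :&: F)%G.
have sCE : C \subset E := subsetIl _ _.
have nCE : E \subset 'N(C) by rewrite normsI ?normG // norms_cent.
have nZE : E \subset 'N(Z) by rewrite normsI.
have sZC : Z \subset C := subsetIl _ _.
have nsZE : Z <| E by rewrite /normal (subset_trans sZC).
apply: contraT => nsCF.
have ntCZ : C / Z != 1.
  rewrite -subG1 quotient_sub1; last exact: subset_trans sCE nZE.
  by apply: contra nsCF => sCZ; apply: subset_trans sCZ (subsetIr _ _).
have [Mb minM sMC] := minnormal_exists ntCZ (quotient_norms Z nCE).
have nsME : Mb <| E / Z.
  have /mingroupP[/andP[_ nM] _] := minM.
  by rewrite /normal nM (subset_trans sMC) // quotientS.
have [L defM sZL nsLE] := inv_quotientN nsZE nsME.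
have sLC : L \subset C.
  by rewrite -(quotientSGK _ sZC) -?defM // (subset_trans (normal_sub nsLE)).
have sZZL : Z \subset 'Z(L).
  rewrite subsetI sZL /= centsC (subset_trans sLC) //.
  by rewrite (subset_trans (subsetIr E 'C(F))) // centS // subsetIr.
have qL : quasinilpotent L.
  apply: central_charsimple_quasinilpotent sZZL _; rewrite -defM.
  exact: minnormal_charsimple minM.
have sLZ : L \subset Z by rewrite subsetI sLC -defF quasinilpotent_sub_gFitting.
have /mingroupP[/andP[/negP[]]] := minM.
by rewrite defM -subG1 quotient_sub1 // (subset_trans sLZ) ?normG.
Qed.

End QuasinilpotentNormal.

Section GeneralizedFitting.

Variable gT : finGroupType.
Implicit Types (p : nat) (A B C D E G H K L M N P Q R S T X Y Z : {group gT}).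

Lemma three_subgroup_normal N H K L :
    H \subset 'N(N) -> K \subset 'N(N) -> L \subset 'N(N) ->
    [~: H, K, L] \subset N -> [~: K, L, H] \subset N ->
  [~: L, H, K] \subset N.
Proof.
move=> nNH nNK nNL; have nR (B C : {group gT}) : B \subset 'N(N) -> C \subset 'N(N) -> [~: B, C] \subset 'N(N).
  by move=> nB nC; rewrite (subset_trans (commg_sub _ _)) // join_subG nB.
have E3 (A B C : {group gT}) : A \subset 'N(N) -> B \subset 'N(N) -> C \subset 'N(N) ->
    ([~: A, B, C] \subset N) = ([~: A / N, B / N, C / N] == 1).
  move=> nA nB nC; have nAB := nR A B nA nB; have nABC := nR [~: A, B]%G C nAB nC.
  by rewrite -(quotient_sub1 nABC) (quotientR nAB nC) (quotientR nA nB) subG1.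
rewrite !E3 // => /eqP R1 /eqP R2; apply/eqP.
exact: (@three_subgroup _ (H / N)%G (K / N)%G (L / N)%G).
Qed.

Definition iter_comm G k Y := iter k (fun Z => [~: Z, G^`(1)]%G) Y.

Lemma iter_commS G k Y Z :
  Y \subset Z -> iter_comm G k Y \subset iter_comm G k Z.
Proof. by move=> sYZ; elim: k => //= k IHk; apply: commSg. Qed.

Lemma iter_comm_normal G k Y : Y <| G -> iter_comm G k Y <| G.
Proof.
move=> nsY; elim: k => //= k IHk; have nsG' := der_normal 1 G.
have [sYG nYG] := andP IHk; have [sG'G nG'G] := andP nsG'.
rewrite /normal normsR // andbT (subset_trans (commg_sub _ _)) //.
by rewrite join_subG sYG.
Qed.

Lemma hypercyclic_iter_comm G A B :
  hypercyclic G A B -> exists k, iter_comm G k B \subset A.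
Proof.
elim=> [|C D _ [k IHk] /prime_step_der sDC]; first by exists 0.
exists k.+1; rewrite /iter_comm iterSr; apply: subset_trans IHk.
exact: (@iter_commS G k [~: D, G^`(1)]%G C).
Qed.

Lemma hypercyclic_lcn_cent G X :
  hypercyclic G 1 X -> exists n, 'L_n.+1(G^`(1)) \subset 'C(X).
Proof.
elim=> [|B C hB [n IHn] stepBC]; first by exists 0; rewrite cents1.
have [nsB nsC _ _] := stepBC; have sCB := prime_step_der stepBC.
have [k kB] := hypercyclic_iter_comm hB.
have sL m : 'L_m.+1(G^`(1)) \subset G^`(1) := lcn_sub _ _.
have sLG m : 'L_m.+1(G^`(1)) \subset G := subset_trans (sL m) (der_sub 1 G).
exists (n + k); apply/commG1P/trivgP; apply: (subset_trans _ kB).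
rewrite /= commGC; elim: k {kB} => [|k IHk].
  by rewrite addn0; apply: subset_trans sCB; rewrite commgS.
rewrite addnS lcnSn commGC /=.
have nsI := iter_comm_normal k.+1 nsB; have nI := normal_norm nsI.
rewrite commGC [[~: C, _]]commGC.
apply: (@three_subgroup_normal (iter_comm G k.+1 B) G^`(1)%G C 'L_(n + k).+1(G^`(1))%G).
- exact: subset_trans (der_sub 1 G) nI.
- exact: subset_trans (normal_sub nsC) nI.
- exact: subset_trans (sLG _) nI.
- rewrite [[~: G^`(1)%G, C]]commGC.
  apply: subset_trans (sub1G _); apply/trivgP/commG1P.
  apply: subset_trans sCB _; rewrite centsC (subset_trans _ IHn) //.
  by apply: lcn_sub_leq; rewrite ltnS leq_addr.
by rewrite /=; apply: commSg.
Qed.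

Lemma hypercyclic_gFitting G E X :
    E <| G -> X <| G -> generalized_Fitting E \subset X -> X \subset E ->
    hypercyclic G 1 X ->
  hypercyclic G 1 E.
Proof.
move=> nsEG nsXG sFX sXE hX; pose D := (E :&: G^`(1))%G.
have nsDG : D <| G by rewrite normalI ?der_normal.
have sDE : D \subset E := subsetIl _ _.
have [n cL] := hypercyclic_lcn_cent hX.
have [k kX] := hypercyclic_iter_comm hX.
(* This term centralises [X], hence [F^*(E)], hence lies in [F^*(E)]; [k] further commutators inside
   [X] then kill it. *)
have sLn : 'L_n.+1(D) \subset X.
  apply: (subset_trans _ sFX); apply: subset_trans (cent_gFitting E).
  rewrite subsetI (subset_trans (lcn_sub _ _)) //=.
  apply: (subset_trans _ (centS sFX)); apply: subset_trans cL.
  by apply: lcnS; apply: subsetIr.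
have nilD : nilpotent D.
  apply/lcnP; exists (n + k); apply/trivgP; apply: (subset_trans _ kX).
  elim: k {kX} => [|k IHk]; first by rewrite addn0.
  by rewrite /= addnS lcnSn; apply: commgSS; rewrite ?subsetIr.
have sDX : D \subset X.
  apply: (subset_trans _ sFX); apply: quasinilpotent_sub_gFitting.
    exact: normalS sDE (normal_sub nsEG) nsDG.
  exact: nilpotent_quasinilpotent.
have hD : hypercyclic G 1 D.
  have := hypercyclicI nsDG hX; have -> : (X :&: D)%G = D by apply/val_inj/setIidPr.
  by have -> : (1 :&: D)%G = 1%G by apply/val_inj/setIidPl/sub1G.
apply: chain_trans hD _; apply: hypercyclic_of_chief => // A B chAB sDA sBE.
have minB := chief_factor_minnormal chAB.
have /andP[/maxgroupp/andP[prAB nAG] nsBG] := chAB.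
have sBG := normal_sub nsBG; have nAB := subset_trans sBG nAG.
have cBG : B / A \subset 'C(G / A).
  rewrite quotient_cents2 //; apply: subset_trans sDA; rewrite subsetI.
  rewrite (subset_trans _ sBE) ?commg_subl ?normal_norm //=.
  exact: commSg.
have abB : abelian (B / A) by apply: (subset_trans cBG); rewrite centS ?quotientS.
have [_ ntB /is_abelemP[q prq abq]] :=
  minnormal_solvable minB (subxx _) (abelian_sol abB).
have [x Bx ntx] := trivgPn _ ntB.
have /mingroupP[_ minB'] := minB.
have <-: #|<[x]>| = #|B : A|.
  rewrite -card_quotient //; congr #|(_ : {set _})|; apply: minB'; last by rewrite cycle_subG.
  by rewrite cycle_eq1 ntx cents_norm // centsC cycle_subG (subsetP cBG).
by rewrite -orderE (abelem_order_p abq).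
Qed.

End GeneralizedFitting.

(** * Formations *)

Section Formations.

Variable F : group_class.
Hypotheses (formF : formation F).

Lemma formation_isog (gT rT : finGroupType) (G : {group gT}) (H : {group rT}) :
  G \isog H -> F G -> F H.
Proof.
case/isogP=> f _ eqH FG; have [homF _] := formF.
by rewrite (_ : H = (f @* G)%G); [apply: homF | apply/val_inj/esym].
Qed.

(** The map sending [x] to [(f x, g x)] identifies [H / N] with a subdirect product of the two
    images. *)
Lemma formation_kernels (gT rT1 rT2 : finGroupType) (H N : {group gT})
    (f : {morphism H >-> rT1}) (g : {morphism H >-> rT2}) :
  N :=: 'ker f :&: 'ker g -> F (f @* H)%G -> F (g @* H)%G -> F (H / N)%G.
Proof.
move=> eqN Ff Fg; pose h x := (f x, g x).
have hM : {in H &, {morph h : x y / x * y}}.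
  by move=> x y Hx Hy; rewrite /h !morphM.
pose hm := Morphism hM; have [_ subF] := formF.
have -> : N = ('ker hm)%G.
  apply/val_inj/setP=> x; rewrite /= eqN !inE /= /h.
  apply/idP/idP.
    by case/andP=> /andP[Hx /eqP fx] /andP[_ /eqP gx]; rewrite Hx fx gx eqxx.
  by case/andP=> Hx /eqP[fx gx]; rewrite Hx fx gx !eqxx.
apply: (formation_isog (G := (hm @* H)%G)).
  by rewrite isog_sym first_isog.
apply: subF Ff Fg; rewrite /= !morphimEdom -imset_comp; exact: eq_imset.
Qed.

End Formations.

(** Order [p ^ 2] is what gives [<[c]>] a Frattini subgroup of order [p], the future copy of the
    prime order subgroup; [e] prescribes the action on it. *)
Lemma power_conjugation (p e : nat) :
    prime p -> coprime p e ->
  exists (gT : finGroupType) (c y : gT), #[c] = (p ^ 2)%N /\ c ^ y = c ^+ e.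
Proof.
move=> prp cope; pose q := (p ^ 2)%N.
have q_gt1 : 1 < q by rewrite -(expn0 p) ltn_exp2l ?prime_gt1.
pose b : 'Z_q := Zp1; pose B := <[b]>%G.
have ob : #[b] = q by rewrite order_Zp1 Zp_cast.
have injf : 'injm (cyclem e b).
  apply/subsetP=> x /morphpreP[Bx /set1P xe]; rewrite inE -order_eq1 -dvdn1.
  have coqe : gcdn q e = 1%N by apply/eqP; rewrite -/(coprime q e) coprimeXl.
  have xq : #[x] %| q by rewrite -[X in _ %| X]ob order_dvdG.
  by rewrite -coqe dvdn_gcd xq order_dvdn; apply/eqP.
have fBB : cyclem e b @* <[b]> = <[b]>.
  by apply/eqP; rewrite eqEcard card_injm // leqnn andbT; apply/subsetP=> _ /morphimP[x _ Bx ->]; rewrite groupX.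
pose s := aut injf fBB; have As : s \in Aut B := Aut_aut injf fBB.
pose to := [Aut B]%gact.
exists (sdprod_by to), (sdpair1 to b), (sdpair2 to s); split.
  by rewrite order_injm ?injm_sdpair1 ?cycle_id.
rewrite -sdpair_act ?cycle_id // -morphX ?cycle_id //; congr (sdpair1 to _).
by rewrite /= /autact /= apermE autE ?cycle_id.
Qed.

(** * Extensions by normal subgroups of prime order *)

Section PrimeExtension.

Variable F : group_class.
Hypotheses (formF : formation F) (satF : solubly_saturated F).
Hypothesis supF : supersolvable_sub F.

(* With L = <n> and c of order p ^ 2, let H be the normaliser in G x K of the
   diagonal D = <(n, c ^ p)>, where K = <c> <y> and y acts on <c ^ p> as G does on
   L.  H projects onto G and onto the supersolvable group K, and in H / D the
   image of <(1, c)> has Frattini subgroup (L x <c ^ p>) / D. *)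
Lemma formation_prime_ext (gT : finGroupType) (G L : {group gT}) :
  L <| G -> prime #|L| -> F (G / L)%G -> F G.
Proof.
move=> nsLG prL FGL; have [sLG nLG] := andP nsLG; have [homF _] := formF.
set p := #|L| in prL.
have [n defL] := cyclicP (prime_cyclic prL).
have on : #[n] = p by rewrite orderE -defL.
have Ln : n \in L by rewrite defL cycle_id.
have Gn := subsetP sLG n Ln.
have cycA : cyclic (conj_aut L @* G).
  by apply: cyclicS (Aut_conj_aut L G) _; rewrite Aut_prime_cyclic.
have [sg defA] := cyclicP cycA.
have [g0 Ng0 [Gg0 def_sg]] : exists2 g0, g0 \in 'N(L) & g0 \in G /\ sg = conj_aut L g0.
  have: sg \in conj_aut L @* G by rewrite defA cycle_id.
  by case/morphimP=> g0 Ng0 Gg0 ->; exists g0.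
(* [G] acts on [L] through the cyclic group generated by the action of [g0], so only [g0] needs a
   partner [y] in [K]; elements centralising [L] are paired with 1. *)
have decG x : x \in G -> exists i, x * g0 ^- i \in 'C(L).
  move=> Gx; have Nx := subsetP nLG x Gx.
  have: conj_aut L x \in <[sg]> by rewrite -defA mem_morphim.
  case/cycleP=> i eqx; exists i; rewrite -ker_conj_aut.
  apply/kerP; first by rewrite groupM ?groupV ?groupX.
  by rewrite morphM ?groupV ?groupX // morphV ?groupX // morphX //= -def_sg eqx mulgV.
have [e ne] : exists e, n ^ g0 = n ^+ e.
  by apply/cycleP; rewrite -defL memJ_norm.
have cope : coprime p e.
  have: generator <[n]> (n ^+ e).
    by rewrite -ne /generator -defL cycleJ -defL; apply/eqP/esym/normP.
  by rewrite generator_coprime on.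
have [kT [c [y [oc cy]]]] := power_conjugation prL cope.
pose K := (<[c]> <*> <[y]>)%G; pose z := c ^+ p.
have oz : #[z] = p by rewrite orderXdiv oc -mulnn ?mulnK ?dvdn_mulr ?prime_gt0.
have zy : z ^ y = z ^+ e by rewrite conjXg cy -!expgM mulnC.
have nsTK : <[c]> <| K.
  rewrite /normal joing_subl join_subG normG cycle_subG.
  by rewrite inE -cycleJ cy cycleX.
have FK : F K.
  apply: supF; exists [:: <[c]>%G; K] => //=; rewrite normal_refl nsTK !sub1G joing_subl /=.
  rewrite quotient_cyclic ?cycle_cyclic //= andbT.
  rewrite quotientYidl; last by rewrite (subset_trans (joing_subr <[c]> _)) ?normal_norm.
  by rewrite quotient_cyclic ?cycle_cyclic.
have Kc : c \in K by rewrite (subsetP (joing_subl _ _)) ?cycle_id.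
have Ky : y \in K by rewrite (subsetP (joing_subr _ _)) ?cycle_id.
have Kz : z \in K by rewrite groupX.
pose d : gT * kT := (n, z); pose D := <[d]>%G.
have expp (a : gT) (u : kT) i : (a, u) ^+ i = (a ^+ i, u ^+ i) :> gT * kT.
  by elim: i => // i IHi; rewrite !expgS IHi.
have conjp (a a' : gT) (u u' : kT) : (a, u) ^ (a', u') = (a ^ a', u ^ u') :> gT * kT by [].
pose H := 'N_(setX G K)(D)%G.
have Hdef (a : gT) (u : kT) : a \in G -> u \in K -> (a, u) \in 'N(D) -> (a, u) \in H.
  by move=> Ga Ku Nau; rewrite inE Nau inE Ga Ku.
have HG x : x \in H -> x.1 \in G by case: x => a u /setIP[/setXP[]].
have HK x : x \in H -> x.2 \in K by case: x => a u /setIP[/setXP[]].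
have nDH : H \subset 'N(D) := subsetIr _ _.
have Hc : (1, c) \in H.
  apply: Hdef => //; apply: (subsetP (cent_sub _)); rewrite cent_cycle; apply/cent1P.
  by rewrite /commute /d; congr (_, _); rewrite ?mul1g ?mulg1 // -expgS -expgSr.
have HC x : x \in G -> x \in 'C(L) -> (x, 1) \in H.
  move=> Gx cx; apply: Hdef => //; apply: (subsetP (cent_sub _)); rewrite cent_cycle; apply/cent1P.
  by rewrite /commute /d; congr (_, _); rewrite ?mul1g ?mulg1 // (centP cx).
have Hg0 : (g0, y) \in H.
  apply: Hdef => //; rewrite inE -cycleJ cycle_subG conjp ne zy.
  by rewrite -expp mem_cycle.
have Hd : d \in H by apply: Hdef; rewrite ?Gn ?Kz // (subsetP (normG _)) ?cycle_id.
pose f1 := restrm_morphism (subsetT H) (fst_morphism gT kT).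
pose f2 := restrm_morphism (subsetT H) (snd_morphism gT kT).
have im1 : f1 @* H = G.
  apply/eqP; rewrite eqEsubset; apply/andP; split.
    by apply/subsetP=> _ /morphimP[x _ Hx ->]; apply: HG.
  apply/subsetP=> x Gx; have [i cx] := decG x Gx.
  have Hxi : (x * g0 ^- i, 1) * (g0, y) ^+ i \in H.
    by rewrite groupM ?groupX ?HC // groupM ?groupV ?groupX.
  apply/morphimP; exists ((x * g0 ^- i, 1) * (g0, y) ^+ i) => //.
  change (x = x * g0 ^- i * ((g0, y) ^+ i).1).
  by rewrite expp /= mulgKV.
have im2 : f2 @* H = K.
  apply/eqP; rewrite eqEsubset; apply/andP; split.
    by apply/subsetP=> _ /morphimP[x _ Hx ->]; apply: HK.
  rewrite join_subG !cycle_subG; apply/andP; split; apply/morphimP.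
    by exists (1, c).
  by exists (g0, y).
have nsDH : D <| H by rewrite /normal nDH cycle_subG Hd.
pose Z := <[z]>%G; have sZT : Z \subset <[c]> by rewrite cycle_subG mem_cycle.
have nZK : K \subset 'N(Z).
  rewrite join_subG; apply/andP; split.
    exact: sub_abelian_norm (cycle_abelian c) sZT.
  by rewrite cycle_subG inE -cycleJ zy cycleX.
pose M := [group of setX L Z].
have memM x : x \in M -> exists i j, x = (n ^+ i, z ^+ j).
  by case: x => a u; rewrite inE defL /= => /andP[/cycleP[i ->] /cycleP[j ->]]; exists i, j.
have Hz : (1, z) \in H.
  by have := groupX p Hc; rewrite expp expg1n.
(* Modulo [D], [n] becomes the inverse of [z], so every element of [M] is congruent to a power of
   [(1, z)]. *)
have mulM i j : (n ^+ i, z ^+ j) = d ^+ i * ((1, z) ^- i * (1, z) ^+ j) :> gT * kT.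
  have mulp (a a' : gT) (u u' : kT) : (a, u) * (a', u') = (a * a', u * u') :> gT * kT by [].
  have invp (a : gT) (u : kT) : (a, u)^-1 = (a^-1, u^-1) :> gT * kT by [].
  by rewrite /d !expp !expg1n invp !mulp invg1 !mulg1 mulKVg.
have sDM : D \subset M by rewrite cycle_subG inE /= Ln cycle_id.
have sMH : M \subset H.
  apply/subsetP=> x /memM[i [j ->]].
  by rewrite mulM groupM ?groupX // groupM ?groupV ?groupX.
have nsMH : M <| H.
  rewrite /normal sMH; apply/subsetP=> -[a u] Hau; rewrite inE.
  have Na := subsetP nLG a (HG _ Hau); have Nu := subsetP nZK u (HK _ Hau).
  apply/subsetP=> _ /imsetP[[a' u'] /setXP[La Zu] ->].
  by rewrite conjp inE /= !memJ_norm ?La.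
(* [M] is the common kernel of the maps from [H] onto [G / L] and onto [K / Z]. *)
have FHM : F (H / M)%G.
  have nL1 : f1 @* H \subset 'N(L) by rewrite im1.
  have nZ2 : f2 @* H \subset 'N(Z) by rewrite im2.
  have dom1 : H \subset f1 @*^-1 'N(L) by rewrite -sub_morphim_pre.
  have dom2 : H \subset f2 @*^-1 'N(Z) by rewrite -sub_morphim_pre.
  pose h1 := restrm_morphism dom1 [morphism of coset_morphism L \o f1].
  pose h2 := restrm_morphism dom2 [morphism of coset_morphism Z \o f2].
  have imh1 : h1 @* H = G / L by rewrite morphim_restrm setIid morphim_comp im1.
  have imh2 : h2 @* H = K / Z by rewrite morphim_restrm setIid morphim_comp im2.
  apply: (formation_kernels formF (f := h1) (g := h2)).
  - apply/setP=> -[a u]; apply/idP/idP => [Mau | /setIP[k1 k2]].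
      have Hau := subsetP sMH _ Mau; have /setXP[La Zu] := Mau.
      by apply/setIP; split; apply/kerP => //; apply: coset_id.
    have Hau := dom_ker k1; have Na := subsetP nLG a (HG _ Hau).
    have Nu := subsetP nZK u (HK _ Hau).
    by apply/setXP; split; [apply: coset_idr Na (mker k1) | apply: coset_idr Nu (mker k2)].
  - by rewrite (_ : (h1 @* H)%G = (G / L)%G) //; apply/val_inj.
  rewrite (_ : (h2 @* H)%G = (restrm_morphism nZK (coset_morphism Z) @* K)%G).
    exact: homF.
  by apply/val_inj; rewrite /= imh2 morphim_restrm setIid.
have FHD : F (H / D)%G.
  pose c1 : gT * kT := (1, c); pose N0 := (<[coset D c1]>)%G.
  have ND1c := subsetP nDH _ Hc.
  have defN0 : N0 = <[c1]> / D :> {set _} by rewrite /= quotient_cycle.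
  have nsN0 : N0 <| H / D.
    rewrite defN0 quotient_normal // /normal cycle_subG Hc.
    apply/subsetP=> -[a u] Hau; rewrite inE -cycleJ cycle_subG /c1 conjp conj1g.
    have: c ^ u \in <[c]> by rewrite memJ_norm ?cycle_id // (subsetP (normal_norm nsTK)) // (HK _ Hau).
    by case/cycleP=> i ->; apply/cycleP; exists i; rewrite expp expg1n.
  apply: satF nsN0 _ _; first by rewrite abelian_sol ?cycle_abelian.
  have pN0 : p.-group N0.
    rewrite defN0 quotient_pgroup // /pgroup -orderE.
    have: #[c1] %| p ^ 2.
      by rewrite order_dvdn /c1 expp expg1n -oc expg_order.
    by move/pnat_dvd; apply; rewrite pnatX pnat_id.
  have defPhi : 'Phi(N0) = M / D.
    rewrite (Phi_Mho pN0) ?cycle_abelian // (Mho_p_cycle 1 pN0) expn1 -morphX //=.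
    rewrite /c1 expp expg1n -/z; apply/eqP; rewrite eqEsubset cycle_subG mem_quotient /=; last first.
      by rewrite inE /= group1 cycle_id.
    apply/subsetP=> _ /morphimP[x Nx /memM[i [j def_x]] ->]; rewrite def_x mulM.
    have N1z : (1, z) \in 'N(D) := subsetP nDH _ Hz.
    have Nd : d \in 'N(D) := subsetP nDH _ Hd.
    rewrite /= coset_kerl ?groupX ?cycle_id //.
    by rewrite morphM ?groupV ?groupX // morphV ?groupX // !morphX // groupM ?groupV ?mem_cycle.
  have eqPhi : 'Phi(N0)%G = (M / D)%G by apply/val_inj.
  rewrite eqPhi; apply: (formation_isog formF _ FHM).
  by rewrite isog_sym third_isog.
(* Reduction modulo [D] and projection to [K] have trivial common kernel: [n] and [z] have the same
   order, so [z ^+ i = 1] forces [n ^+ i = 1]. *)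
have FH : F H.
  pose g1 := restrm_morphism nDH (coset_morphism D).
  apply: (@formation_isog F formF _ _ (H / 1)%G).
    by rewrite isog_sym quotient1_isog.
  apply: (formation_kernels formF (f := g1) (g := f2)).
  - apply/esym/trivgP/subsetP=> -[a u] /setIP[k1 k2].
    have Hau := dom_ker k1; have u1 : u = 1 := mker k2.
    have: (a, u) \in D := coset_idr (subsetP nDH _ Hau) (mker k1).
    case/cycleP=> i; rewrite expp => -[-> ez].
    have ni : n ^+ i = 1 by apply/eqP; rewrite -order_dvdn on -oz order_dvdn -ez u1.
    by apply/set1P; rewrite ni u1.
  - rewrite (_ : (g1 @* H)%G = (H / D)%G) //.
    by apply/val_inj; rewrite /= morphim_restrm setIid.
  by rewrite (_ : (f2 @* H)%G = K) //; apply/val_inj.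
by rewrite (_ : G = (f1 @* H)%G); [apply: homF | apply/val_inj/esym].
Qed.

Lemma formation_hypercyclic (gT : finGroupType) (G E : {group gT}) :
  hypercyclic G 1 E -> F (G / E)%G -> F G.
Proof.
move=> hE FGE; apply: (@formation_isog F formF _ _ (G / 1)%G).
  by rewrite isog_sym quotient1_isog.
elim: hE FGE => // B C _ IH [nsB nsC sBC [i1 | prBC]] FGC; apply: IH.
  by rewrite (_ : B = C) //; apply/val_inj/index1g.
apply: (formation_prime_ext (quotient_normal B nsC)).
  by rewrite card_quotient // (subset_trans (normal_sub nsC)) ?normal_norm.
apply: (formation_isog formF _ FGC).
by rewrite isog_sym third_isog.
Qed.

End PrimeExtension.

Theorem theoremC (F : group_class) (gT : finGroupType) (G E X : {group gT}) :
  formation F -> solubly_saturated F -> supersolvable_sub F ->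
  E <| G -> F _ (G / E)%G ->
  X <| G -> generalized_Fitting E \subset X -> X \subset E ->
  (forall (p : nat) (P : {group gT}), prime p -> p.-Sylow(X) P -> ~~ cyclic P ->
     maximal_Pi G P \/ cyclic_Pi G P) ->
  F _ G.
Proof.
move=> formF satF supF nsEG FGE nsXG sFX sXE chX.
apply: (formation_hypercyclic formF satF supF _ FGE).
apply: (hypercyclic_gFitting nsEG nsXG sFX sXE).
apply: sylow_chains_hypercyclic => // p P prp sylP ncycP.
have [sPX pP _] := and3P sylP; have sPG := subset_trans sPX (normal_sub nsXG).
have [maxP | cycP] := chX p P prp sylP ncycP.
  by left; apply: maximal_chainsP.
by right; apply: cyclic_chainsP.
Qed.
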